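(* For each $m\in\mathbb N$, let $C^{(m)}\in\mathbb F_2^{\mathbb N\times m}$ generate a one-dimensional binary digital $(0,m,1)$-net $P_{2^m}$. Let $P_{2^m}^{\mathrm{scr}}$ denote either the matrix-scrambled point set $P_{2^m}^{\mathrm{mat},\boldsymbol\delta}$ with a fixed digital shift $\boldsymbol\delta$, or the linearly scrambled point set $P_{2^m}^{\mathrm{lin}}$ (the assertions hold in both cases). Then, as $m\to\infty$, $$ R_\infty(P_{2^m}^{\mathrm{scr}})=\Theta_{\mathbb P}(2^{-m}m^{-1}), \qquad \rho_\infty(P_{2^m}^{\mathrm{scr}})=\Theta_{\mathbb P}(m). $$ Moreover, in both cases there are constants $C>0$ and $m_0$ such that, for every $m\ge m_0$ and every $1\le u\le m/4$, $$ \mathbb P\left(R_\infty(P_{2^m}^{\mathrm{scr}})<\frac1{8u}\,\frac{2^{-m}}{m}\right)\le Cu^{-1}, \qquad \mathbb P\left(R_\infty(P_{2^m}^{\mathrm{scr}})>8u\,\frac{2^{-m}}{m}\right)\le Cu^{-1}. $$ In the case of matrix scrambling, the constants and bounds are uniform over the fixed shift $\boldsymbol\delta$.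
   Context: One-dimensional binary digital point sets: given $C\in\mathbb F_2^{\mathbb N\times m}$, for $\boldsymbol a\in\mathbb F_2^m$ the point $x_{\boldsymbol a}$ is $\sum_{r\ge1}y_r2^{-r}$, where $(y_r)_{r\ge1}=C\boldsymbol a$ is its specified output digit vector. Membership of a digital point in a dyadic interval is determined by these specified digits. It is a digital $(0,m,1)$-net if every dyadic interval $[a2^{-m},(a+1)2^{-m})$, $0\le a<2^m$, contains exactly one of the $2^m$ points. Scrambling: let $L$ be a random infinite lower triangular matrix over $\mathbb F_2$ with ones on the diagonal and independent uniform entries below the diagonal. Given a digital shift $\boldsymbol\delta\in\mathbb F_2^{\mathbb N}$, replace the output digit vector $\boldsymbol y$ of every point by $L\boldsymbol y\oplus\boldsymbol\delta$ ($\oplus$ is digitwise addition in $\mathbb F_2$). With $\boldsymbol\delta$ deterministic this is matrix scrambling, giving $P_{2^m}^{\mathrm{mat},\boldsymbol\delta}$ (probability over $L$ only). If all digits of $\boldsymbol\delta$ are independent uniform and independent of $L$, it is linear scrambling, giving $P_{2^m}^{\mathrm{lin}}$ (probability over $L$ and $\boldsymbol\delta$). For an $N$-point multiset $P=(x_n)$ in $[0,1]$ with $N\ge2$: $R_\infty(P)$ is the minimum of $|x_n-x_{n'}|$ over different indices, $h_\infty(P)=\sup_{z\in[0,1]}\min_{n}|z-x_n|$, $\rho_\infty(P)=2h_\infty(P)/R_\infty(P)$ ($=\infty$ if $R_\infty(P)=0$). Probabilistic order: $X_m=O_{\mathbb P}(a_m)$ means that for every $\varepsilon>0$ there are $C_\varepsilon>0$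 and $m_\varepsilon$ with $\mathbb P(|X_m|>C_\varepsilon a_m)\le\varepsilon$ for all $m\ge m_\varepsilon$; $X_m=\Omega_{\mathbb P}(a_m)$ means $a_m/X_m=O_{\mathbb P}(1)$; $X_m=\Theta_{\mathbb P}(a_m)$ means both. *)

(* Defs.v *)
From HB Require Import structures.
From mathcomp Require Import all_boot all_order all_algebra.
From mathcomp Require Import all_classical all_reals all_analysis.

Set Implicit Arguments.
Unset Strict Implicit.
Unset Printing Implicit Defensive.

Import Order.TTheory GRing.Theory Num.Theory.
Import numFieldNormedType.Exports.

Local Open Scope classical_set_scope.
Local Open Scope ring_scope.

(* Digits are indexed from 0: position k carries the weight 2^-(k+1). *)
Definition digits := nat -> 'F_2.

Definition digits_val (R : realType) (y : digits) : R :=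
  limn (series (fun k => (nat_of_ord (y k))%:R / 2 ^+ k.+1 : R)).

Definition gen_digits (m : nat) (C : nat -> 'I_m -> 'F_2)
    (a : {ffun 'I_m -> 'F_2}) : digits :=
  fun k => \sum_(j < m) C k j * a j.

(* The point with digit vector y lies in [c 2^-m, (c+1) 2^-m).  Membership is
   decided by the specified digits: the first m of them spell c in base 2.
   (The real value alone would misplace expansions with trailing ones.) *)
Definition in_dyadic (m c : nat) (y : digits) : Prop :=
  (\sum_(k < m) nat_of_ord (y k) * 2 ^ (m - k.+1))%N = c.

Definition digital_0m1_net (m : nat) (C : nat -> 'I_m -> 'F_2) : Prop :=
  forall c : nat, (c < 2 ^ m)%N ->
    exists! a : {ffun 'I_m -> 'F_2}, in_dyadic m c (gen_digits C a).

Definition unit_lower_triangular (L : nat -> nat -> 'F_2) : Prop :=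
  (forall i, L i i = 1) /\ (forall i j, (i < j)%N -> L i j = 0).

(* L y (+) delta; for lower triangular L, row k of the infinite product L y
   only involves columns 0, ..., k. *)
Definition scramble (L : nat -> nat -> 'F_2) (delta : digits) (y : digits) :
    digits :=
  fun k => (\sum_(j < k.+1) L k j * y j) + delta k.

Definition scr_points (R : realType) (m : nat) (C : nat -> 'I_m -> 'F_2)
    (L : nat -> nat -> 'F_2) (delta : digits) : {ffun 'I_m -> 'F_2} -> R :=
  fun a => digits_val R (scramble L delta (gen_digits C a)).

(* A finite point multiset is a family x indexed by a finite type.  The infima
   over n are minima, being taken over finite sets; those sets are nonempty as
   soon as I has at least two elements. *)
Definition Rinf (R : realType) (I : finType) (x : I -> R) : R :=
  inf [set `|x p.1 - x p.2| | p in [set p : I * I | p.1 != p.2]].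

Definition hinf (R : realType) (I : finType) (x : I -> R) : R :=
  sup [set inf [set `|z - x n| | n in [set: I]] | z in `[0, 1]%classic].

Definition rhoinf (R : realType) (I : finType) (x : I -> R) : \bar R :=
  if Rinf x == 0 then +oo%E else (2 * hinf x / Rinf x)%:E.

Section random_digits.
Context (R : realType) (d : measure_display) (T : measurableType d)
  (P : probability T R).

(* 'F_2 carries the discrete sigma-algebra. *)
Definition mutually_independent (I : eqType) (X : I -> T -> 'F_2) : Prop :=
  forall (J : seq I) (B : I -> set 'F_2), uniq J ->
    P (\bigcap_(i in [set` J]) (X i @^-1` B i)) =
    (\prod_(i <- J) P (X i @^-1` B i))%E.

Definition iid_uniform (I : eqType) (X : I -> T -> 'F_2) : Prop :=
  [/\ forall i (B : set 'F_2), measurable (X i @^-1` B),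
      forall i (b : 'F_2), P (X i @^-1` [set b]) = (2^-1)%:E
    & mutually_independent X].

Definition below_diag : Type := {p : nat * nat | (p.2 < p.1)%N}.

Definition below_entry (L : T -> nat -> nat -> 'F_2) (p : below_diag) :
    T -> 'F_2 :=
  fun w => L w (\val p).1 (\val p).2.

Definition random_scrambling_matrix (L : T -> nat -> nat -> 'F_2) : Prop :=
  (forall w, unit_lower_triangular (L w)) /\ iid_uniform (below_entry L).

(* Entries of L and digits of delta form one independent family, which also
   makes delta independent of L. *)
Definition random_linear_scrambling (L : T -> nat -> nat -> 'F_2)
    (delta : T -> digits) : Prop :=
  (forall w, unit_lower_triangular (L w)) /\
  iid_uniform (fun s : below_diag + nat =>
    match s with
    | inl p => below_entry L p
    | inr k => fun w => delta w k
    end).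

End random_digits.

Section stochastic_order.
Context (R : realType) (d : nat -> measure_display)
  (T : forall m, measurableType (d m)) (P : forall m, probability (T m) R).

(* Stochastic orders, uniformly over a parameter i : I; X_m may live on a
   probability space depending on m. *)
Definition unif_OP (I : Type) (X : I -> forall m, T m -> \bar R)
    (a : nat -> R) : Prop :=
  forall eps : R, 0 < eps ->
    exists K : R, 0 < K /\
    exists m0 : nat, forall (i : I) (m : nat), (m0 <= m)%N ->
      (P m [set w | (K * a m)%:E < `|X i m w|] <= eps%:E)%E.

(* In \bar R, a / 0 = +oo and a / +oo = 0 for a > 0. *)
Definition unif_OmegaP (I : Type) (X : I -> forall m, T m -> \bar R)
    (a : nat -> R) : Prop :=
  unif_OP (fun i m w => (a m)%:E / X i m w)%E (fun=> 1).

Definition unif_ThetaP (I : Type) (X : I -> forall m, T m -> \bar R)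
    (a : nat -> R) : Prop :=
  unif_OP X a /\ unif_OmegaP X a.

Definition ThetaP (X : forall m, T m -> \bar R) (a : nat -> R) : Prop :=
  unif_ThetaP (fun _ : unit => X) a.

End stochastic_order.

(* Main.v *)
Require Import Defs.
From HB Require Import structures.
From mathcomp Require Import all_boot all_order all_algebra.
From mathcomp Require Import all_classical all_reals all_analysis.
From mathcomp Require Import measurable_realfun.
From mathcomp Require Import zify ring lra.

Set Implicit Arguments.
Unset Strict Implicit.
Unset Printing Implicit Defensive.

Import Order.TTheory GRing.Theory Num.Theory.
Import numFieldNormedType.Exports.

Local Open Scope classical_set_scope.
Local Open Scope ring_scope.

(** Scrambling keeps the net property, since a unit lower triangular matrix acts
    bijectively on the leading m digits. A net with [2 ^ m] points has covering
    radius between [2 ^- m / 2] and [2 ^- m] ([net_hinf_ge], [net_hinf_le]), so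
    the mesh ratio is [2 ^- m / Rinf] up to a factor 2 and everything reduces to
    tail bounds for the separation radius.

    Two points at distance less than [2 ^- n] have leading n digits that spell
    consecutive integers, and then the digitwise sum of these digits is 0...01...1
    ([prefix_succ]). This digitwise sum is the scrambled image, without shift, of
    the sum v of the two inputs. When n = m + l, the position j < m of its first 1
    already determines v through the leading m digits, and the remaining l digits
    of the image are uniform: the entries of L in the rows m, ..., m + l - 1 and
    the columns below m add to them a uniform random matrix applied to a nonzero
    vector. Summing over j, a close pair exists with probability at most
    [m / 2 ^ l] ([card_close_pair]), whatever the shift is.

    Conversely, if for some j the first m + l digits of the image of v are 0...01...1,
    and some scrambled point has digit j equal to 0 and the digits j + 1, ...,
    m + l - 1 equal to 1, then adding v to the input of that point gives a point
    at distance at most [2 * 2 ^- (m + l)]. There are about m choices of j, each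
    successful for v with probability [2 ^- l], and for each j >= m / 2 there are at
    least [2 ^ (m / 2)] candidates for the point. Values of a uniform random matrix
    at distinct nonzero vectors of F_2^m are pairwise independent
    ([card_mul_eq2]), so Chebyshev's inequality ([pairwise_indep_none]) bounds the
    probability of failure by a multiple of [2 ^ l / m]
    ([card_no_consecutive_pair]).

    Both kinds of scrambling enter only through [scrambling_law]: the law of the
    leading part of (L, delta) does not change when a matrix is added to the block
    of L described above. Therefore it suffices to count, for each fixed value of
    everything else, the proportion of bad blocks ([prob_le_block_proportion]).
    Taking [2 ^ l] of order u m, respectively m / u, gives the tail bounds, and
    these give the stochastic orders. *)

(** * Binary digits and their values *)

Lemma F2P (x : 'F_2) : x = 0 \/ x = 1.
Proof. by case: x => [[|[|?]] lt] //; [left|right]; apply: val_inj. Qed.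

Lemma val_F2_0 : nat_of_ord (0 : 'F_2) = 0%N. Proof. by []. Qed.
Lemma val_F2_1 : nat_of_ord (1 : 'F_2) = 1%N. Proof. by []. Qed.
Definition val_F2 := (val_F2_0, val_F2_1).

Lemma F2_neq0 (x : 'F_2) : x != 0 -> x = 1.
Proof. by case: (F2P x) => ->. Qed.

Lemma F2_addxx (x : 'F_2) : x + x = 0.
Proof. by case: (F2P x) => ->; apply: val_inj. Qed.

Definition prefix (n : nat) (y : digits) : nat :=
  (\sum_(k < n) nat_of_ord (y k) * 2 ^ (n - k.+1))%N.

Lemma prefixS n y : prefix n.+1 y = (2 * prefix n y + y n)%N.
Proof.
rewrite /prefix big_ord_recr /= subnn muln1 big_distrr /=; congr (_ + _)%N.
by apply: eq_bigr => i _; rewrite mulnCA -expnS subSn.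
Qed.

Lemma prefix_lt n y : (prefix n y < 2 ^ n)%N.
Proof.
elim: n => [|n IH]; first by rewrite /prefix big_ord0.
by rewrite prefixS expnS; case: (F2P (y n)) => ->; rewrite val_F2; lia.
Qed.

Lemma prefix_inj n y z :
  prefix n y = prefix n z -> forall k, (k < n)%N -> y k = z k.
Proof.
elim: n => [//|n IH]; rewrite !prefixS => E k.
have [En eqn] : prefix n y = prefix n z /\ y n = z n.
  by move: E; case: (F2P (y n)) => ->; case: (F2P (z n)) => ->;
    rewrite !val_F2; split=> //; lia.
by rewrite ltnS leq_eqVlt => /orP[/eqP->//|]; apply: IH.
Qed.

Lemma eq_prefix n y z :
  (forall k, (k < n)%N -> y k = z k) -> prefix n y = prefix n z.
Proof. by move=> E; apply: eq_bigr => k _; rewrite E. Qed.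

(** Incrementing a binary number flips its last 0 together with the block of 1s
    after it, so the digitwise sum of consecutive numbers is 0...01...1. *)
Lemma prefix_succ n (y z : digits) : prefix n z = (prefix n y).+1 ->
  exists2 j, (j < n)%N &
    forall k, (k < n)%N -> y k + z k = (j <= k)%N%:R.
Proof.
elim: n => [|n IH]; first by rewrite /prefix !big_ord0.
rewrite !prefixS => E.
case: (F2P (y n)) => yn; case: (F2P (z n)) => zn; rewrite yn zn !val_F2 in E; try lia.
- exists n => // k; rewrite ltnS leq_eqVlt => /orP[/eqP->|kn].
    by rewrite yn zn add0r leqnn.
  have /prefix_inj -> // : prefix n y = prefix n z by lia.
  by rewrite F2_addxx leqNgt kn.
- have [|j jn H] := IH; first lia.
  exists j; first exact: leqW.
  move=> k; rewrite ltnS leq_eqVlt => /orP[/eqP->|]; last exact: H.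
  by rewrite yn zn addr0 (ltnW jn).
Qed.

Lemma succ_prefix n j (y z : digits) : (j < n)%N -> y j = 0 ->
  (forall k, (j < k < n)%N -> y k = 1) ->
  (forall k, (k < n)%N -> y k + z k = (j <= k)%N%:R) ->
  prefix n z = (prefix n y).+1.
Proof.
elim: n => [//|n IH] jn yj y1 E; rewrite !prefixS.
have zE k : (k < n.+1)%N -> z k = y k + (j <= k)%N%:R.
  by move=> kn; rewrite -E // addrA F2_addxx add0r.
move: jn; rewrite ltnS leq_eqVlt => /orP[/eqP jn|jn].
  have -> : prefix n z = prefix n y.
    apply: eq_prefix => k kn; rewrite zE ?(leqW kn) //.
    by rewrite jn leqNgt kn addr0.
  by rewrite zE // jn leqnn -jn yj add0r !val_F2; lia.
have yn : y n = 1 by apply: y1; rewrite jn ltnSn.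
rewrite zE // (ltnW jn) yn [1 + _]F2_addxx IH ?val_F2 //.
- lia.
- by move=> k /andP[jk kn]; apply: y1; rewrite jk leqW.
- by move=> k kn; apply: E; rewrite leqW.
Qed.

Section digits_val.
Variable R : realType.
Implicit Types y z : digits.

Lemma series_prefix y n :
  series (fun k => (nat_of_ord (y k))%:R / 2 ^+ k.+1 : R) n
  = (prefix n y)%:R / 2 ^+ n.
Proof.
elim: n => [|n IH]; first by rewrite /series /= big_geq // /prefix big_ord0 mul0r.
rewrite seriesSr IH prefixS natrD natrM mulrDl exprS; congr (_ + _).
by rewrite invfM mulrACA divff ?mul1r // pnatr_eq0.
Qed.

Lemma nondecreasing_prefix y n k :
  (prefix n y)%:R / 2 ^+ n <= (prefix (k + n) y)%:R / 2 ^+ (k + n) :> R.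
Proof.
elim: k => [//|k IH]; apply: le_trans IH _.
rewrite addSn -!series_prefix seriesSr lerDl.
by rewrite mulr_ge0 // invr_ge0 exprn_ge0.
Qed.

(** The dyadic intervals named by the successive prefixes are nested. *)
Lemma nonincreasing_prefix y n k :
  (prefix (k + n) y).+1%:R / 2 ^+ (k + n) <= (prefix n y).+1%:R / 2 ^+ n :> R.
Proof.
elim: k => [//|k IH]; apply: le_trans IH.
have p : 0 < 2 ^+ (k + n) :> R by rewrite exprn_gt0.
rewrite addSn prefixS exprS ler_pdivrMr ?mulr_gt0 // mulrACA.
rewrite mulVf ?gt_eqF // mulr1 -natrM ler_nat.
by case: (F2P (y (k + n)%N)) => ->; rewrite val_F2; lia.
Qed.

Lemma digits_val_cvg y :
  cvgn (series (fun k => (nat_of_ord (y k))%:R / 2 ^+ k.+1 : R)).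
Proof.
apply: nondecreasing_is_cvgn.
  apply/nondecreasing_seqP => n; rewrite seriesSr lerDl.
  by rewrite mulr_ge0 // invr_ge0 exprn_ge0.
exists 1 => _ [n _ <-]; rewrite series_prefix ler_pdivrMr ?exprn_gt0 // mul1r.
by rewrite -natrX ler_nat ltnW // prefix_lt.
Qed.

Lemma digits_val_ge y n : (prefix n y)%:R / 2 ^+ n <= digits_val R y.
Proof.
apply: limr_ge; first exact: digits_val_cvg.
exists n => // N /= nN.
by rewrite series_prefix -(subnK nN) nondecreasing_prefix.
Qed.

Lemma digits_val_le y n : digits_val R y <= (prefix n y).+1%:R / 2 ^+ n.
Proof.
apply: limr_le; first exact: digits_val_cvg.
exists n => // N /= nN.
rewrite series_prefix -(subnK nN); apply: (le_trans _ (nonincreasing_prefix _ _ (N - n))).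
by rewrite ler_pM2r ?invr_gt0 ?exprn_gt0 // ler_nat.
Qed.

Lemma digits_val_ge0 y : 0 <= digits_val R y.
Proof. by have := digits_val_ge y 0; rewrite /prefix big_ord0 mul0r. Qed.

Lemma digits_val_le1 y : digits_val R y <= 1.
Proof. by have := digits_val_le y 0; rewrite /prefix big_ord0 expr0 divr1. Qed.

Lemma digits_val_succ n y z : prefix n z = (prefix n y).+1 ->
  `|digits_val R y - digits_val R z| <= 2 * 2 ^- n.
Proof.
move=> E.
have := digits_val_ge y n; have := digits_val_le y n.
have := digits_val_ge z n; have := digits_val_le z n.
rewrite E -!natr1 !mulrDl !mul1r.
have : 0 <= 2 ^- n :> R by rewrite invr_ge0 exprn_ge0.
move: (_^-1) (_ / _) => e p *; rewrite ler_norml; apply/andP; split; lra.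
Qed.

Lemma digits_val_close n y z : `|digits_val R y - digits_val R z| < 2 ^- n ->
  (prefix n z <= (prefix n y).+1)%N.
Proof.
rewrite ltr_norml => /andP[lb _]; rewrite leqNgt; apply/negP => lt.
have := digits_val_le y n; have := digits_val_ge z n.
have : ((prefix n y).+1.+1%:R / 2 ^+ n <= (prefix n z)%:R / 2 ^+ n :> R).
  by rewrite ler_pM2r ?invr_gt0 ?exprn_gt0 // ler_nat.
rewrite -[in X in X <= _ -> _]natr1 mulrDl mul1r.
move: lb; move: (_^-1) (_ / _) (_ / _) => e p q; lra.
Qed.

End digits_val.

(** * Pairwise independence of the values of a uniform random matrix *)

Lemma card_fiber (G H : finZmodType) (f : G -> H) (c : H) :
  {morph f : x y / x + y} -> (forall h, exists g, f g = h) ->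
  (#|[pred g | f g == c]| * #|H|)%N = #|G|.
Proof.
move=> fD fsurj.
have fib h : #|[pred g | f g == h]| = #|[pred g | f g == c]|.
  have [g0 fg0] := fsurj (h - c).
  rewrite -(fintype.card_image (can_inj (addrK g0)) [pred g | f g == c]).
  apply: eq_card => g; rewrite !inE; apply/eqP/fintype.imageP => [fg|[g' + ->]].
    by exists (g - g0); rewrite ?subrK // inE; apply/eqP;
      apply: (addIr (f g0)); rewrite -fD subrK fg fg0 addrC subrK.
  by rewrite inE fD => /eqP->; rewrite fg0 addrC subrK.
rewrite -[RHS](@sum1_card G) (partition_big f xpredT) //= mulnC -sum_nat_const.
by apply: eq_bigr => h _; rewrite sum1_card -(fib h).
Qed.

Section uniform_matrix.
Variables l m : nat.
Notation G := ('M['F_2]_(l, m)).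
Implicit Types (v : 'cV['F_2]_m) (c : 'cV['F_2]_l).

Lemma separating_functional v1 v2 : v1 != 0 -> v1 != v2 ->
  exists2 w : 'rV['F_2]_m, w *m v1 = 1%:M & w *m v2 = 0.
Proof.
have eM (i : 'I_m) v : delta_mx 0 i *m v = (v i 0)%:M.
  by rewrite -rowE; apply/matrixP => a b; rewrite !mxE !ord1 eqxx.
move=> v1n0 v12.
have [/existsP[i /andP[/eqP v1i /eqP v2i]]|nex] :=
    boolP [exists i, (v1 i 0 == 1) && (v2 i 0 == 0)].
  by exists (delta_mx 0 i); rewrite eM ?v1i ?v2i ?raddf0.
(* Otherwise the support of v1 lies strictly inside that of v2, and adding a
   coordinate of v2 outside v1 cancels the value at v2. *)
have sub i : v1 i 0 = 1 -> v2 i 0 = 1.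
  move=> v1i; apply: F2_neq0; apply: contra nex => v2i.
  by apply/existsP; exists i; rewrite v1i eqxx.
have /cV0Pn[i /F2_neq0 v1i] := v1n0.
have : v2 - v1 != 0 by rewrite subr_eq0 eq_sym.
move=> /cV0Pn[k]; rewrite !mxE.
case: (F2P (v1 k 0)) => v1k; last by rewrite (sub _ v1k) v1k subrr eqxx.
rewrite v1k subr0 => /F2_neq0 v2k.
exists (delta_mx 0 i + delta_mx 0 k).
  by rewrite mulmxDl !eM v1i v1k raddf0 addr0.
by rewrite mulmxDl !eM (sub _ v1i) v2k -raddfD F2_addxx raddf0.
Qed.

Lemma card_mul_eq v c : v != 0 ->
  (#|[pred b : G | b *m v == c]| * 2 ^ l)%N = #|{: G}|.
Proof.
move=> v0; have [w wv _] := separating_functional v0 v0.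
have -> : (2 ^ l)%N = #|{: 'cV['F_2]_l}| by rewrite card_mx card_Fp // muln1.
apply: card_fiber => [x y|h]; first exact: mulmxDl.
by exists (h *m w); rewrite -mulmxA wv mulmx1.
Qed.

Lemma card_mul_eq2 v1 v2 c1 c2 : v1 != 0 -> v2 != 0 -> v1 != v2 ->
  (#|[pred b : G | (b *m v1 == c1) && (b *m v2 == c2)]| * (2 ^ l * 2 ^ l))%N
  = #|{: G}|.
Proof.
move=> v10 v20 v12.
have [w1 w11 w12] := separating_functional v10 v12.
have [w2 w22 w21] := separating_functional v20 (introN eqP (fun e =>
  negP v12 (introT eqP (esym e)))).
have -> : (2 ^ l * 2 ^ l)%N = #|{: 'M['F_2]_(l, 1 + 1)}|.
  by rewrite card_mx card_Fp // muln2 -addnn expnD.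
rewrite -(@card_fiber _ _ (fun b : G => b *m row_mx v1 v2) (row_mx c1 c2)).
- congr (_ * _)%N; apply: eq_card => b; rewrite !inE mul_mx_row.
  apply/andP/eqP => [[/eqP-> /eqP->]//|/eq_row_mx[-> ->]]; exact: conj.
- by move=> x y; rewrite mulmxDl.
- move=> h; exists (lsubmx h *m w1 + rsubmx h *m w2).
  rewrite mul_mx_row !mulmxDl -!mulmxA w11 w12 w21 w22 !mulmx1 !mulmx0.
  by rewrite addr0 add0r hsubmxK.
Qed.

End uniform_matrix.

(** Chebyshev's inequality for the number of events that occur, when the events
    are pairwise independent with probability [1 / q] under the uniform
    distribution on [G]: that number has mean [#|I| / q] and variance at most
    its mean. *)
Lemma pairwise_indep_none (G I : finType) (E : I -> pred G) (q : nat) :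
  (forall i, #|E i| * q = #|G|)%N ->
  (forall i j, i != j -> #|[predI E i & E j]| * (q * q) = #|G|)%N ->
  (#|[pred g | [forall i, ~~ E i g]]| * #|I| <= #|G| * q)%N.
Proof.
move=> E1 E2.
have [->|I0] := posnP #|I|; first by rewrite muln0.
(* S1 and S2 are the first two moments of the number N of events that occur,
   cleared of denominators; V is its variance scaled in the same way. *)
pose N g : int := \sum_i (E i g)%:R.
have cardE (A : pred G) : \sum_g (A g)%:R = #|A|%:R :> int.
  rewrite -sum1_card natr_sum [RHS]big_mkcond /=; apply: eq_bigr => g _.
  by rewrite -[g \in A]/(A g); case: (A g).
have S1 : (\sum_g N g) * q%:R = #|I|%:R * #|G|%:R.
  rewrite exchange_big mulr_suml /= (eq_bigr (fun=> #|G|%:R)).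
    by rewrite sumr_const mulr_natl.
  by move=> i _; rewrite cardE -natrM E1.
have S2 : (\sum_g N g ^+ 2) * (q%:R * q%:R)
        = #|I|%:R * (#|I|%:R - 1 + q%:R) * #|G|%:R.
  have -> : \sum_g N g ^+ 2 = \sum_i \sum_j #|[predI E i & E j]|%:R.
    under eq_bigr => g _ do rewrite expr2 big_distrlr /=.
    rewrite exchange_big /=; apply: eq_bigr => i _.
    rewrite exchange_big /=; apply: eq_bigr => j _.
    by rewrite -cardE; apply: eq_bigr => g _; rewrite -natrM mulnb.
  rewrite mulr_suml (eq_bigr (fun=> (#|I|%:R - 1 + q%:R) * #|G|%:R)).
    by rewrite sumr_const -mulrA mulr_natl.
  move=> i _; rewrite mulr_suml (bigD1 i) //=.
  rewrite (eq_bigr (fun=> #|G|%:R)); last first.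
    by move=> j ji; rewrite -!natrM E2 // eq_sym.
  rewrite sumr_const cardC1 addrC mulrDl.
  congr (_ + _); first by rewrite -subn1 mulrnBr // mulrBl mul1r mulr_natl mulr1n.
  rewrite -(E1 i) !natrM (_ : #|[predI E i & E i]| = #|E i|); first by ring.
  by apply: eq_card => g; rewrite !inE andbb.
have V : \sum_g (N g * q%:R - #|I|%:R) ^+ 2 = #|I|%:R * (q%:R - 1) * #|G|%:R.
  under eq_bigr => g _ do rewrite sqrrB exprMn [q%:R ^+ 2]expr2.
  rewrite big_split /= sumrB sumrMnl -!mulr_suml S2 S1 sumr_const.
  rewrite -[_ *+ #|_|]mulr_natl -[_ *+ 2]mulr_natl; ring.
have B : #|[pred g | [forall i, ~~ E i g]]|%:R * #|I|%:R ^+ 2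
    <= \sum_g (N g * q%:R - #|I|%:R) ^+ 2.
  rewrite -cardE mulr_suml; apply: ler_sum => g _ /=.
  case: (boolP [forall _, _]) => [/forallP none|_]; last by rewrite mul0r sqr_ge0.
  rewrite /N big1 ?mul0r ?sub0r ?sqrrN ?mul1r // => i _.
  by rewrite (negPf (none i)).
rewrite V in B.
rewrite -(leq_pmul2r I0) -(ler_nat int) !natrM.
move: B; have : 0 <= #|I|%:R * #|G|%:R :> int by rewrite mulr_ge0.
move: (_%:R) (_%:R) (_%:R) (_%:R) => a b c e; nia.
Qed.

Lemma card_cover (T I : finType) (B : pred T) (E : I -> pred T) :
  (forall t, B t -> exists i, E i t) -> (#|B| <= \sum_i #|E i|)%N.
Proof.
move=> cov; have -> : (\sum_i #|E i| = \sum_t \sum_i E i t)%N.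
  rewrite exchange_big; apply: eq_bigr => i _.
  rewrite -sum1_card [LHS]big_mkcond /=; apply: eq_bigr => t _.
  by rewrite -[t \in _]/(E i t); case: (E i t).
rewrite -sum1_card big_mkcond /=; apply: leq_sum => t _.
rewrite -[t \in B]/(B t); case: ifP => // /cov[i Ei].
by rewrite (bigD1 i) //= Ei.
Qed.

Lemma square_le_exp2 k : (k ^ 2 <= 2 * (2 ^ k - 1))%N.
Proof.
case: k => [|[|[|[|k]]]] //.
have -> : k.+4 = (k + 4)%N by rewrite addnC.
suff: ((k + 4) ^ 2 + 2 <= 2 * 2 ^ (k + 4))%N by lia.
elim: k => [//|k]; rewrite addSn (expnS 2) -!mulnn; nia.
Qed.

(** * The scrambling matrix acting on the leading digits *)

Section scramble_linear.
Variables (m : nat) (C : nat -> 'I_m -> 'F_2).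
Notation A := {ffun 'I_m -> 'F_2}.
Notation zero_shift := (fun=> 0 : 'F_2).
Implicit Types (a v : A) (L : nat -> nat -> 'F_2) (delta y : digits).

Definition scr_digits L delta a : digits := scramble L delta (gen_digits C a).

Lemma gen_digitsD a v k :
  gen_digits C (a + v) k = gen_digits C a k + gen_digits C v k.
Proof.
rewrite /gen_digits -big_split /=; apply: eq_bigr => j _.
by rewrite ffunE mulrDr.
Qed.

Lemma scr_digitsD L delta a v k :
  scr_digits L delta (a + v) k
  = scr_digits L delta a k + scr_digits L zero_shift v k.
Proof.
rewrite /scr_digits /scramble addr0 addrAC -big_split /=; congr (_ + _).
by apply: eq_bigr => j _; rewrite gen_digitsD mulrDr.
Qed.

Lemma eq_scr_digits n L L' delta delta' a :
  (forall k j, (k < n)%N -> (j < n)%N -> L k j = L' k j) ->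
  (forall k, (k < n)%N -> delta k = delta' k) ->
  forall k, (k < n)%N -> scr_digits L delta a k = scr_digits L' delta' a k.
Proof.
move=> EL Ed k kn; rewrite /scr_digits /scramble Ed //; congr (_ + _).
apply: eq_bigr => j _; rewrite EL //.
by apply: leq_ltn_trans kn; rewrite -ltnS.
Qed.

Definition head_col a : 'cV['F_2]_m := \col_(k < m) gen_digits C a k.

Hypothesis netC : digital_0m1_net C.

Lemma gen_digits_head_inj a v :
  (forall k, (k < m)%N -> gen_digits C a k = gen_digits C v k) -> a = v.
Proof.
move=> E; have [w [_ uw]] := netC (prefix_lt m (gen_digits C a)).
have <- : w = a by apply: uw.
by apply: uw; apply/esym; apply: eq_prefix.
Qed.

Lemma head_col_inj : injective head_col.
Proof.
move=> a v /matrixP E; apply: gen_digits_head_inj => k km.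
by have := E (Ordinal km) 0; rewrite !mxE.
Qed.

Lemma head_col_neq0 a : a != 0 -> head_col a != 0.
Proof.
apply: contra_neq => E; apply: head_col_inj; rewrite E.
apply/matrixP => k j; rewrite !mxE /gen_digits big1 // => i _.
by rewrite ffunE mulr0.
Qed.

(** By forward substitution a unit lower triangular matrix determines the
    leading m digits of the input from those of the output, so scrambling keeps
    the net property. *)
Lemma scr_digits_head_inj L delta a v : unit_lower_triangular L ->
  (forall k, (k < m)%N -> scr_digits L delta a k = scr_digits L delta v k) ->
  a = v.
Proof.
move=> [diag _] E; apply: gen_digits_head_inj => k.
have [n] := ubnP k; elim: n k => // n IH k; rewrite ltnS => kn km.
have := E k km; rewrite /scr_digits /scramble => /addIr.
rewrite !big_ord_recr /= diag !mul1r.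
under eq_bigr => j _.
  rewrite IH; [|by apply: leq_trans kn; apply: ltn_ord
               |by apply: ltn_trans km; apply: ltn_ord].
  over.
by move/addrI.
Qed.

Lemma scr_digits_head_surj L delta y : unit_lower_triangular L ->
  exists a, forall k, (k < m)%N -> scr_digits L delta a k = y k.
Proof.
move=> ultL; pose f a : A := [ffun k : 'I_m => scr_digits L delta a k].
have f_inj : injective f.
  move=> a v /ffunP E; apply: (scr_digits_head_inj (delta := delta) ultL).
  by move=> k km; have := E (Ordinal km); rewrite !ffunE.
have [g _ fg] := injF_bij f_inj.
exists (g [ffun k : 'I_m => y k]) => k km.
by have /ffunP/(_ (Ordinal km)) := fg [ffun k : 'I_m => y k]; rewrite !ffunE.
Qed.

(** Two of the scrambled points may differ by less than [2 ^- n] only if some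
    scrambled difference [v] has the digits 0...01...1: their first n digits must
    spell consecutive integers. *)
Definition close_pair L n := exists2 j, (j < m)%N &
  exists v, forall k, (k < n)%N -> scr_digits L zero_shift v k = (j <= k)%N%:R.

(** This is a sufficient condition for two points within [2 * 2 ^- n]: carrying a
    1 into the block of 1s of the scrambled [a] amounts to adding [v]. *)
Definition consecutive_pair L delta n := exists2 j, (j < m)%N & exists a v,
  [/\ forall k, (k < n)%N -> scr_digits L zero_shift v k = (j <= k)%N%:R,
      scr_digits L delta a j = 0
    & forall k, (j < k < n)%N -> scr_digits L delta a k = 1].

(** Close pairs, like consecutive pairs below, only depend on the leading n x n
    part of the matrix, which is a finite amount of randomness. *)
Lemma eq_close_pair L L' n :
  (forall k j, (k < n)%N -> (j < n)%N -> L k j = L' k j) ->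
  close_pair L n -> close_pair L' n.
Proof.
move=> EL [j jm [v H]]; exists j => //; exists v => k kn; rewrite -H //.
by apply: eq_scr_digits kn => // ? ? ? ?; rewrite EL.
Qed.

Lemma eq_consecutive_pair L L' delta delta' n : (m <= n)%N ->
  (forall k j, (k < n)%N -> (j < n)%N -> L k j = L' k j) ->
  (forall k, (k < n)%N -> delta k = delta' k) ->
  consecutive_pair L delta n -> consecutive_pair L' delta' n.
Proof.
move=> mn EL Ed [j jm [a [v [H a0 a1]]]].
have E k : (k < n)%N -> scr_digits L' delta' a k = scr_digits L delta a k.
  by move=> kn; apply: eq_scr_digits kn => *; rewrite ?EL ?Ed.
exists j => //; exists a, v; split.
- move=> k kn; rewrite -H //.
  by apply: eq_scr_digits kn => // ? ? ? ?; rewrite EL.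
- by rewrite E // (leq_trans jm).
- by move=> k jkn; rewrite E ?a1 //; case/andP: jkn.
Qed.

(** The first 1 of the sum must occur among the leading m digits, because the
    heads of two distinct points differ. *)
Lemma scr_digits_succ L delta a v n : unit_lower_triangular L -> a != v ->
  prefix n (scr_digits L delta v) = (prefix n (scr_digits L delta a)).+1 ->
  (m <= n)%N -> close_pair L n.
Proof.
move=> ultL anv /prefix_succ[j jn H] mn.
have Hv k : (k < n)%N -> scr_digits L zero_shift (a + v) k = (j <= k)%N%:R.
  move=> kn; rewrite -H // scr_digitsD.
  have := scr_digitsD L delta 0 v k; have := scr_digitsD L delta 0 a k.
  rewrite !add0r => -> ->; by rewrite [RHS]addrACA [X in _ = X + _]F2_addxx add0r.
have [jm|mj] := ltnP j m; first by exists j => //; exists (a + v).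
case/eqP: anv; apply: (scr_digits_head_inj (delta := delta) ultL) => k km.
have /eqP := H k (leq_trans km mn).
rewrite leqNgt (leq_trans km mj) /= addr_eq0 => /eqP->.
by case: (F2P (scr_digits L delta v k)) => ->; apply: val_inj.
Qed.

End scramble_linear.

(** * Randomising the block of rows m, ..., m + l - 1 and columns below m *)

Section block.
Variables (m l : nat) (C : nat -> 'I_m -> 'F_2).
Notation A := {ffun 'I_m -> 'F_2}.
Notation G := ('M['F_2]_(l, m)).
Notation zero_shift := (fun=> 0 : 'F_2).
Implicit Types (a v : A) (b : G) (L : nat -> nat -> 'F_2) (delta y : digits).

(** The matrix b placed in the rows m, ..., m + l - 1 and the columns below m of
    an infinite matrix, all other entries being 0. *)
Definition block_entry b (k j : nat) : 'F_2 :=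
  if (m <= k)%N then
    match insub (k - m)%N, insub j with
    | Some i, Some j' => b i j' | _, _ => 0
    end
  else 0.

Definition add_block b L k j : 'F_2 := L k j + block_entry b k j.

Lemma block_entryE b (i : 'I_l) (j : 'I_m) : block_entry b (m + i) j = b i j.
Proof. by rewrite /block_entry leq_addr addKn !valK. Qed.

Lemma block_entry_top b k j : (k < m)%N -> block_entry b k j = 0.
Proof. by move=> km; rewrite /block_entry [(m <= k)%N]leqNgt km. Qed.

Lemma block_entry_right b k j : (m <= j)%N -> block_entry b k j = 0.
Proof.
rewrite /block_entry => mj; case: ifP => // _; case: insubP => // i _ _.
by rewrite insubF // ltnNge mj.
Qed.

Lemma block_entry_upper b k j : (k <= j)%N -> block_entry b k j = 0.
Proof.
have [km _|mk kj] := ltnP k m; first exact: block_entry_top.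
exact: block_entry_right (leq_trans mk kj).
Qed.

Lemma scr_digits_add_block_top b L delta a k : (k < m)%N ->
  scr_digits C (add_block b L) delta a k = scr_digits C L delta a k.
Proof.
move=> km; rewrite /scr_digits /scramble; congr (_ + _); apply: eq_bigr => j _.
by rewrite /add_block block_entry_top ?addr0.
Qed.

Lemma scr_digits_add_block b L delta a (i : 'I_l) :
  scr_digits C (add_block b L) delta a (m + i)
  = scr_digits C L delta a (m + i) + (b *m head_col C a) i 0.
Proof.
rewrite /scr_digits /scramble [RHS]addrAC; congr (_ + _).
rewrite /add_block; under eq_bigr => j _ do rewrite mulrDl.
rewrite big_split /=; congr (_ + _).
rewrite -addnS big_split_ord /= [X in _ + X]big1 ?addr0; last first.
  by move=> j _; rewrite block_entry_right ?mul0r ?leq_addr.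
rewrite mxE; apply: eq_bigr => j _.
by rewrite block_entryE mxE.
Qed.

Hypothesis netC : digital_0m1_net C.

(** The value that [b] must give to the input digits [head_col C a] for the
    digits m, ..., m + l - 1 of the scrambled point of [a] to be all 1. *)
Definition ones_target L delta a : 'cV['F_2]_l :=
  \col_(i < l) (1 - scr_digits C L delta a (m + i)).

Lemma ones_targetP b L delta a :
  reflect (forall k, (m <= k < m + l)%N ->
             scr_digits C (add_block b L) delta a k = 1)
          (b *m head_col C a == ones_target L delta a).
Proof.
apply: (iffP eqP) => [E k /andP[mk kml]|E].
  have km : (k - m < l)%N by rewrite ltn_subLR.
  have -> : k = (m + Ordinal km)%N by rewrite /= subnKC.
  by rewrite scr_digits_add_block E mxE addrC subrK.
apply/matrixP => i j; rewrite ord1 [RHS]mxE.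
have := E (m + i)%N; rewrite leq_addr ltn_add2l ltn_ord => /(_ isT).
by rewrite scr_digits_add_block => <-; rewrite addrC addKr.
Qed.

Section fixed_matrix.
Variables (L : nat -> nat -> 'F_2) (delta : digits).
Hypothesis ultL : unit_lower_triangular L.

Lemma exists_ones_suffix_head : exists V : 'I_m -> A,
  forall (j : 'I_m) k, (k < m)%N ->
    scr_digits C L zero_shift (V j) k = (j <= k)%N%:R.
Proof.
have ex (j : 'I_m) : exists v, forall k, (k < m)%N ->
    scr_digits C L zero_shift v k = (j <= k)%N%:R.
  exact: (scr_digits_head_surj netC zero_shift (fun k => (j <= k)%N%:R) ultL).
by have [V HV] := choice ex; exists V.
Qed.

(** The input to be added for incrementing the leading m digits of a scrambled
    point whose last 0 among them is digit j. *)
Let step := sval (cid exists_ones_suffix_head).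
Let step_head : forall (j : 'I_m) k, (k < m)%N ->
  scr_digits C L zero_shift (step j) k = (j <= k)%N%:R :=
  svalP (cid exists_ones_suffix_head).

Lemma scr_digits_zero k : scr_digits C L zero_shift 0 k = 0.
Proof.
rewrite /scr_digits /scramble addr0 big1 // => i _.
by rewrite /gen_digits big1 ?mulr0 // => j _; rewrite ffunE mulr0.
Qed.

Lemma step_neq0 j : step j != 0.
Proof.
apply/eqP => E; have := step_head j (ltn_ord j).
by rewrite E leqnn scr_digits_zero.
Qed.

Lemma step_inj : injective step.
Proof.
have le i j : step i = step j -> (i <= j)%N.
  move=> E; have := step_head i (ltn_ord j); rewrite E step_head // leqnn.
  by case: leqP.
by move=> i j E; apply/val_inj/anti_leq; rewrite !le.
Qed.

(** For each of the m positions of the first 1, the input with the required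
    leading digits is unique, and the other l digits of its image are uniform. *)
Lemma card_close_pair :
  (#|[pred b : G | `[< close_pair C (add_block b L) (m + l) >]]| * 2 ^ l
   <= m * #|{: G}|)%N.
Proof.
pose E (j : 'I_m) : pred G :=
  [pred b | b *m head_col C (step j) == ones_target L zero_shift (step j)].
have -> : (m * #|{: G}| = (\sum_j #|E j|) * 2 ^ l)%N.
  rewrite big_distrl /= (eq_bigr (fun=> #|{: G}|)) ?sum_nat_const ?card_ord //.
  by move=> j _; rewrite card_mul_eq // head_col_neq0 // step_neq0.
rewrite leq_mul2r; apply/orP; right; apply: card_cover => b /asboolP[j jm [v H]].
exists (Ordinal jm); rewrite /E /=.
have -> : step (Ordinal jm) = v.
  apply: (scr_digits_head_inj netC (delta := zero_shift) ultL) => k km.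
  by rewrite step_head // -(scr_digits_add_block_top b) // H // ltn_addr.
apply/ones_targetP => k /andP[mk kml]; rewrite H //.
by rewrite (leq_trans (ltnW jm) mk).
Qed.

(** The block leaves the leading m digits unchanged, so the candidates for the
    lower point of a pair can be listed before the block is drawn. *)
Definition zero_then_ones j : pred A := fun a =>
  (scr_digits C L delta a j == 0) &&
  [forall k : 'I_m, (j < k)%N ==> (scr_digits C L delta a k == 1)].

Lemma card_zero_then_ones j : (j < m)%N ->
  (2 ^ j <= #|[pred a | zero_then_ones j a]|)%N.
Proof.
move=> jm.
have ext (p : {ffun 'I_j -> 'F_2}) : exists a, forall k, (k < m)%N ->
    scr_digits C L delta a k =
    if insub k is Some i then p i else (j < k)%N%:R.
  exact: (scr_digits_head_surj netC delta (fun k => if insub k is Some i then p i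
    else (j < k)%N%:R) ultL).
have [F HF] := choice ext.
have F_inj : injective F.
  move=> p q E; apply/ffunP => i.
  have im : (i < m)%N by apply: ltn_trans jm.
  by have := HF p i im; rewrite E HF // valK.
have <- : #|{: {ffun 'I_j -> 'F_2}}| = (2 ^ j)%N.
  by rewrite card_ffun card_Fp // card_ord.
rewrite -(card_codom F_inj); apply/subset_leq_card/fintype.subsetP => _ /codomP[p ->].
rewrite inE /zero_then_ones HF // insubF ?ltnn //=.
apply/forallP => k; apply/implyP => jk; rewrite HF // insubF ?jk //.
by rewrite ltnNge ltnW.
Qed.

(** Distinct nonzero candidates have pairwise independent tails; the candidate 0,
    whose tail the block does not move, is the reason for the -1. *)
Lemma card_no_completion j : (j < m)%N ->
  (#|[pred b : G | [forall a, (zero_then_ones j a && (a != 0%R)) ==>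
        (b *m head_col C a != ones_target L delta a)]]| * (2 ^ j - 1)
   <= #|{: G}| * 2 ^ l)%N.
Proof.
move=> jm.
pose I := {a : A | zero_then_ones j a && (a != 0)}.
have cI : (2 ^ j - 1 <= #|{: I}|)%N.
  rewrite card_sig leq_subLR (leq_trans (card_zero_then_ones jm)) //.
  rewrite [X in (X <= _)%N](cardD1 (0 : A)) leq_add ?leq_b1 //.
  by apply/eq_leq/eq_card => a; rewrite !inE andbC.
pose E (i : I) : pred G :=
  [pred b | b *m head_col C (val i) == ones_target L delta (val i)].
have := @pairwise_indep_none _ _ E (2 ^ l).
have n0 (i : I) : head_col C (val i) != 0.
  by apply: head_col_neq0 => //; case/andP: (valP i).
move=> /(_ (fun i => card_mul_eq _ (n0 i))).
have ne (i i' : I) : i != i' -> head_col C (val i) != head_col C (val i').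
  by apply: contra_neq => /(head_col_inj netC)/val_inj.
move=> /(_ (fun i i' ii => card_mul_eq2 _ _ (n0 i) (n0 i') (ne _ _ ii))).
apply: leq_trans; apply: leq_mul cI; apply: subset_leq_card.
apply/fintype.subsetP => b; rewrite !inE => /forallP none; apply/forallP => i.
exact: (implyP (none (val i)) (valP i)).
Qed.

Lemma card_no_ones_suffix m' : (m' <= m)%N ->
  (#|[pred b : G | [forall j : 'I_m, (m - m' <= j)%N ==>
        (b *m head_col C (step j) != ones_target L zero_shift (step j))]]| * m'
   <= #|{: G}| * 2 ^ l)%N.
Proof.
move=> m'm.
have lt (t : 'I_m') : (m - m' + t < m)%N.
  by rewrite -[X in (_ < X)%N](subnK m'm) ltn_add2l.
pose J (t : 'I_m') := Ordinal (lt t).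
pose E t : pred G :=
  [pred b | b *m head_col C (step (J t)) == ones_target L zero_shift (step (J t))].
have := @pairwise_indep_none _ _ E (2 ^ l).
have n0 t : head_col C (step (J t)) != 0 by apply: head_col_neq0 (step_neq0 _).
move=> /(_ (fun i => card_mul_eq _ (n0 i))).
have ne t t' : t != t' -> head_col C (step (J t)) != head_col C (step (J t')).
  apply: contra_neq => /(head_col_inj netC)/step_inj[].
  by move/eqP; rewrite eqn_add2l => /eqP/val_inj.
move=> /(_ (fun i i' ii => card_mul_eq2 _ _ (n0 i) (n0 i') (ne _ _ ii))).
rewrite card_ord; apply: leq_trans; apply: leq_mul => //; apply: subset_leq_card.
apply/fintype.subsetP => b; rewrite !inE => /forallP none; apply/forallP => t.
by have /implyP := none (J t); apply; rewrite /= leq_addr.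
Qed.

(** Only the positions j in the last half of the head are tried: there are enough
    of them for one step to succeed, and each leaves at least [2 ^ (m / 2)]
    candidates, so that a union bound over j costs little. *)
Lemma card_no_consecutive_pair : (1 < m)%N ->
  (#|[pred b : G | `[< ~ consecutive_pair C (add_block b L) delta (m + l) >]]| * m
   <= 9 * (#|{: G}| * 2 ^ l))%N.
Proof.
move=> m1; pose m' := m./2; pose K := (2 ^ (m - m') - 1)%N.
have m'm : (m' <= m)%N by rewrite /m'; lia.
pose no_ones := [pred b : G | [forall j : 'I_m, (m - m' <= j)%N ==>
        (b *m head_col C (step j) != ones_target L zero_shift (step j))]].
pose no_comp (j : 'I_m) := [pred b : G | [forall a, (zero_then_ones j a && (a != 0%R)) ==>
        (b *m head_col C a != ones_target L delta a)]].
set bad := [pred b | _].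
have cov : (#|bad| <= #|no_ones| + \sum_(j < m | (m - m' <= j)%N) #|no_comp j|)%N.
  rewrite -(cardID no_ones bad) leq_add //.
    by apply/subset_leq_card/fintype.subsetP => b; rewrite !inE => /andP[].
  pose E (j : 'I_m) := [pred b | (m - m' <= j)%N && no_comp j b].
  have /card_cover : forall b, [predD bad & no_ones] b -> exists j, E j b.
    move=> b /andP[]; rewrite negb_forall => /existsP[j].
    rewrite negb_imply negbK => /andP[mj /ones_targetP ones] /asboolP ncons.
    exists j; rewrite /= mj /=; apply: contrapT => /negP; apply: contra_not ncons.
    rewrite negb_forall => /existsP[a].
    rewrite negb_imply negbK => /andP[/andP[/andP[/eqP a0 /forallP a1] _]].
    move=> /ones_targetP aones; exists j => //; exists a, (step j); split.
    - move=> k kml; have [km|mk] := ltnP k m.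
        by rewrite scr_digits_add_block_top ?step_head.
      by rewrite ones ?mk // (leq_trans (ltnW (ltn_ord j)) mk).
    - by rewrite scr_digits_add_block_top.
    - move=> k /andP[jk kml]; have [km|mk] := ltnP k m; last by rewrite aones ?mk.
      have /implyP/(_ jk)/eqP := a1 (Ordinal km).
      by rewrite scr_digits_add_block_top.
  move=> /leq_trans; apply.
  rewrite [X in (_ <= X)%N]big_mkcond /=; apply: leq_sum => j _.
  by case: ifP => mj; [exact: leqnn | rewrite eq_card0].
have b1 := card_no_ones_suffix m'm.
have b2 : (#|no_ones| * m' <= #|{: G}| * 2 ^ l)%N := b1.
have b3 : ((\sum_(j < m | (m - m' <= j)%N) #|no_comp j|) * K
           <= m' * (#|{: G}| * 2 ^ l))%N.
  have cJ : (\sum_(j < m | (m - m' <= j)%N) 1 = m')%N.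
    transitivity (\sum_(m - m' <= j < m) 1)%N; first by rewrite big_geq_mkord.
    by rewrite sum_nat_const_nat muln1 subKn.
  rewrite -{2}cJ !big_distrl /=; apply: leq_sum => j mj; rewrite mul1n.
  apply: leq_trans (card_no_completion (ltn_ord j)).
  by rewrite leq_mul2l leq_sub2r ?orbT // leq_pexp2l.
have K0 : (0 < K)%N by rewrite /K subn_gt0 -{1}(expn0 2) ltn_exp2l // /m'; lia.
have sq : (m' ^ 2 <= 2 * K)%N.
  apply: leq_trans (square_le_exp2 _); rewrite leq_exp2r // /m'; lia.
have m3 : (m <= 3 * m')%N by rewrite /m'; lia.
move: (_ * 2 ^ l)%N b2 b3 cov => Q.
move: #|bad| #|no_ones| (\sum_(_ < _ | _) _)%N => x y z b2 b3 cov.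
have : (x * m' * K <= 3 * Q * K)%N.
  apply: (@leq_trans ((y * m') * K + (z * K) * m')%N).
    by rewrite -!mulnA [(K * m')%N]mulnC -mulnDl leq_mul2r cov orbT.
  apply: (@leq_trans (Q * K + (m' * Q) * m')%N).
    by rewrite leq_add // leq_mul.
  rewrite -!mulnn in sq; nia.
rewrite leq_mul2r; nia.
Qed.

End fixed_matrix.
End block.

(** * Separation and covering radius *)

Section radii.
Variables (R : realType) (I : finType).
Implicit Types (x f : I -> R) (c : R).

Lemma inf_finite_attained f (i0 : I) :
  exists i, inf [set f n | n in [set: I]] = f i.
Proof.
exists [arg min_(i < i0) f i]%O; case: arg_minP => // i _ le.
apply/eqP; rewrite eq_le; apply/andP; split.
  by apply: ge_inf; [exists (f i) => _ [n _ <-]; apply: le | exists i].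
by apply: lb_le_inf; [exists (f i0), i0 | move=> _ [n _ <-]; apply: le].
Qed.

Lemma has_lbound_dist x :
  has_lbound [set `|x p.1 - x p.2| | p in [set p : I * I | p.1 != p.2]].
Proof. by exists 0 => _ [p _ <-]. Qed.

Lemma Rinf_le x a b : a != b -> Rinf x <= `|x a - x b|.
Proof. by move=> ab; apply: ge_inf (has_lbound_dist x) _ _; exists (a, b). Qed.

Lemma Rinf_lt x c a0 b0 : a0 != b0 :> I ->
  Rinf x < c <-> exists a b, a != b /\ `|x a - x b| < c.
Proof.
move=> ab0; split => [|[a [b [ab lt]]]]; last exact: le_lt_trans (Rinf_le x ab) lt.
move=> /inf_lt; case; first by exists `|x a0 - x b0|, (a0, b0).
by move=> _ [[a b] /= ab <-] lt; exists a, b.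
Qed.

Lemma Rinf_ge0 x : 0 <= Rinf x.
Proof.
have [[y Ay]|/set0P/negP/negPn/eqP E] := pselect ([set `|x p.1 - x p.2| | p in
  [set p : I * I | p.1 != p.2]] !=set0).
  by apply: lb_le_inf; [exists y | move=> _ [p _ <-]].
by rewrite /Rinf E inf0.
Qed.

Definition dist_to x (z : R) := inf [set `|z - x n| | n in [set: I]].

Lemma dist_to_le x z i : dist_to x z <= `|z - x i|.
Proof. by apply: ge_inf; [exists 0 => _ [n _ <-] | exists i]. Qed.

Lemma dist_to_gt x z c (i0 : I) :
  c < dist_to x z <-> forall i, c < `|z - x i|.
Proof.
split => [lt i|lt]; first exact: lt_le_trans lt (dist_to_le _ _ _).
by rewrite /dist_to; have [i ->] := inf_finite_attained (fun n => `|z - x n|) i0.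
Qed.

Section unit_interval.
Variable x : I -> R.
Hypothesis x01 : forall i, 0 <= x i <= 1.
Variable i0 : I.

Lemma dist_to_le1 z : 0 <= z <= 1 -> dist_to x z <= 1.
Proof.
move=> /andP[z0 z1]; apply: le_trans (dist_to_le _ _ i0) _.
have /andP[? ?] := x01 i0; rewrite ler_norml; apply/andP; split; lra.
Qed.

Lemma has_ubound_dist_to :
  has_ubound [set dist_to x z | z in `[0, 1]%classic].
Proof.
by exists 1 => _ [z + <-]; rewrite /= in_itv; apply: dist_to_le1.
Qed.

Lemma hinf_ge z : 0 <= z <= 1 -> dist_to x z <= hinf x.
Proof.
move=> z01; apply: (@ub_le_sup _ [set dist_to x z | z in `[0, 1]%classic]).
  exact: has_ubound_dist_to.
by exists z => //=; rewrite in_itv.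
Qed.

Lemma hinf_le c : (forall z, 0 <= z <= 1 -> dist_to x z <= c) -> hinf x <= c.
Proof.
move=> le; apply: (@ge_sup _ [set dist_to x z | z in `[0, 1]%classic]).
  by exists (dist_to x 0), 0 => //=; rewrite in_itv /= lexx ler01.
by move=> _ [z + <-]; rewrite /= in_itv; apply: le.
Qed.

(** The distance to the points is 1-Lipschitz in z, so its supremum is detected
    on rational z; this is what makes the covering radius measurable. *)
Lemma hinf_gt c : c < hinf x <->
  exists n k : nat, (k <= n)%N /\ forall i, c < `|k%:R / n.+1%:R - x i|.
Proof.
split; last first.
  move=> [n [k [kn lt]]].
  apply: (@lt_le_trans _ _ (dist_to x (k%:R / n.+1%:R))).
    exact/(dist_to_gt _ _ _ i0).
  by apply: hinf_ge; rewrite divr_ge0 //= ler_pdivrMr // mul1r ler_nat leqW.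
move=> /sup_gt; case.
  by exists (dist_to x 0), 0 => //=; rewrite in_itv /= lexx ler01.
move=> _ [z + <-]; rewrite /= in_itv /= => /andP[z0 z1] lt.
have e0 : 0 < dist_to x z - c by rewrite subr_gt0.
have [n _ /(_ n (leqnn n)) ne] := near_infty_natSinv_lt (PosNum e0).
have zn0 : 0 <= z * n.+1%:R by rewrite mulr_ge0.
(* The minimum matters for z = 1 only. *)
pose k := minn n (Num.truncn (z * n.+1%:R)).
have near : `|z - k%:R / n.+1%:R| <= n.+1%:R^-1.
  rewrite -[X in `|X|](@mulfK _ n.+1%:R) ?pnatr_eq0 // mulrBl divfK ?pnatr_eq0 //.
  rewrite normrM [`|_^-1|]ger0_norm ?invr_ge0 // -[leRHS]mul1r ler_wpM2r ?invr_ge0 //.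
  have unit_dist (y t : R) : t <= y -> y <= t + 1 -> `|y - t| <= 1.
    by move=> ? ?; rewrite ler_norml; apply/andP; split; lra.
  have /andP[tle tlt] := trunc_itv zn0.
  rewrite /k; case: leqP => [nt|tn]; apply: unit_dist.
  - by apply: le_trans tle; rewrite ler_nat.
  - by rewrite natr1 ler_piMl.
  - by [].
  - by rewrite natr1 ltW.
exists n, k; split; first by rewrite geq_minl.
move=> i; have D := ler_distD (k%:R / n.+1%:R) z (x i).
rewrite -(ltrD2l `|z - k%:R / n.+1%:R|); apply: lt_le_trans D.
rewrite -ltrBrDr; apply: le_lt_trans near _; apply: lt_le_trans ne _.
by rewrite /= lerB // dist_to_le.
Qed.

End unit_interval.
End radii.

Section net_radii.
Variables (R : realType) (m : nat) (C : nat -> 'I_m -> 'F_2).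
Notation A := {ffun 'I_m -> 'F_2}.
Variables (L : nat -> nat -> 'F_2) (delta : digits).
Hypothesis netC : digital_0m1_net C.
Hypothesis ultL : unit_lower_triangular L.
Notation x := (scr_points R C L delta).

Lemma scr_points01 a : 0 <= x a <= 1.
Proof. by rewrite digits_val_ge0 digits_val_le1. Qed.

Lemma exists_neq_ffun : (0 < m)%N -> exists a b : A, a != b.
Proof.
move=> m0; exists 0, [ffun=> 1]; apply/eqP => /ffunP/(_ (Ordinal m0)).
by rewrite !ffunE.
Qed.

Lemma Rinf_lt_close_pair n : (0 < m <= n)%N ->
  Rinf x < 2 ^- n -> close_pair C L n.
Proof.
move=> /andP[m0 mn]; have [a0 [b0 ab0]] := exists_neq_ffun m0.
move=> /(Rinf_lt _ _ ab0)[a [b [ab lt]]].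
have le1 := digits_val_close lt.
have le2 : (prefix n (scr_digits C L delta a)
            <= (prefix n (scr_digits C L delta b)).+1)%N.
  by apply: (@digits_val_close R); rewrite distrC.
have [/eqP E|/eqP E|/prefix_inj E] :
  [\/ prefix n (scr_digits C L delta b) == (prefix n (scr_digits C L delta a)).+1,
      prefix n (scr_digits C L delta a) == (prefix n (scr_digits C L delta b)).+1
    | prefix n (scr_digits C L delta a) = prefix n (scr_digits C L delta b)].
- move: le1 le2; rewrite -/(scr_digits C L delta a) -/(scr_digits C L delta b).
  case: (ltngtP (prefix n (scr_digits C L delta a))
                (prefix n (scr_digits C L delta b))) => [lt1 le1 _|lt1 _ le2|//].
  + by constructor 1; rewrite eqn_leq le1.
  + by constructor 2; rewrite eqn_leq le2.
  + by constructor 3.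
- exact: (scr_digits_succ netC ultL ab E mn).
- by rewrite eq_sym in ab; exact: (scr_digits_succ netC ultL ab E mn).
- case/eqP: ab; apply: (scr_digits_head_inj netC (delta := delta) ultL) => k km.
  by apply: E; apply: leq_trans mn.
Qed.

Lemma consecutive_pair_Rinf_le n : (m <= n)%N ->
  consecutive_pair C L delta n -> Rinf x <= 2 * 2 ^- n.
Proof.
move=> mn [j jm [a [v [H a0 a1]]]].
have vn0 : a != a + v.
  apply/eqP => E; have := scr_digitsD C L delta a v j.
  by rewrite -E a0 H ?(leq_trans jm) // leqnn.
apply: le_trans (Rinf_le _ vn0) _; apply: digits_val_succ.
apply: (@succ_prefix n j) => //; first exact: leq_trans mn.
move=> k kn; rewrite -/(scr_digits C L delta (a + v)) scr_digitsD H // addrA.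
by rewrite [X in X + _ = _]F2_addxx add0r.
Qed.

Lemma exists_scr_prefix c : (c < 2 ^ m)%N ->
  exists a, prefix m (scr_digits C L delta a) = c.
Proof.
move=> /netC[a0 [E _]].
have [a H] := scr_digits_head_surj netC delta (gen_digits C a0) ultL.
by exists a; rewrite -[RHS]E; apply: eq_prefix.
Qed.

Lemma net_hinf_le : hinf x <= 2 ^- m.
Proof.
apply: hinf_le => z /andP[z0 z1].
have p0 : 0 < 2 ^+ m :> R by rewrite exprn_gt0.
have [c cm /andP[cz zc]] : exists2 c, (c < 2 ^ m)%N &
    c%:R <= z * 2 ^+ m <= c.+1%:R.
  have zp : 0 <= z * 2 ^+ m by rewrite mulr_ge0 // ltW.
  have /andP[tl tu] := trunc_itv zp.
  have [lt|ge] := ltnP (Num.truncn (z * 2 ^+ m)) (2 ^ m).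
    by exists (Num.truncn (z * 2 ^+ m)) => //; rewrite tl ltW.
  have e0 : (0 < 2 ^ m)%N by rewrite expn_gt0.
  exists (2 ^ m).-1; rewrite prednK // natrX; apply/andP; split.
    by rewrite -truncn_ge_nat //; apply: leq_trans ge; apply: leq_pred.
  by rewrite ler_piMl // ltW.
have [a E] := exists_scr_prefix cm.
apply: le_trans (dist_to_le _ _ a) _.
have := digits_val_ge R (scr_digits C L delta a) m.
have := digits_val_le R (scr_digits C L delta a) m.
rewrite -ler_pdivrMr // in cz; rewrite -ler_pdivlMr // in zc.
move: cz zc; rewrite E -[c.+1%:R]natr1 !mulrDl mul1r.
rewrite -/(scr_points R C L delta a).
rewrite ler_norml => *; apply/andP; split; lra.
Qed.

(** The [2 ^ m] balls of radius [hinf] around the points cover [0, 1], whereas a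
    ball of radius less than [2 ^- m / 2] meets the grid of mesh [2 ^- m] at most
    once, and this grid has [2 ^ m + 1] nodes. *)
Lemma net_hinf_ge : 2 ^- m / 2 <= hinf x.
Proof.
rewrite leNgt; apply/negP => lt.
have p0 : 0 < 2 ^+ m :> R by rewrite exprn_gt0.
have near (i : 'I_(2 ^ m).+1) : exists a, `|i%:R / 2 ^+ m - x a| < 2 ^- m / 2.
  apply: contrapT => nE.
  suff : 2 ^- m / 2 <= dist_to x (i%:R / 2 ^+ m).
    apply/negP; rewrite -ltNge; apply: le_lt_trans lt.
    apply: (hinf_ge scr_points01 0).
    rewrite divr_ge0 ?exprn_ge0 //= ler_pdivrMr // mul1r -natrX ler_nat.
    by rewrite -ltnS ltn_ord.
  rewrite /dist_to; have [a ->] := inf_finite_attained (fun a => `|i%:R / 2 ^+ m - x a|) 0.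
  by rewrite leNgt; apply/negP => lt'; apply: nE; exists a.
have [f Hf] := choice near.
have : ~ injective f.
  by move=> /leq_card; rewrite card_ord card_ffun card_Fp // card_ord ltnn.
apply => i j fij.
have : `|i%:R / 2 ^+ m - j%:R / 2 ^+ m| < 2 ^- m :> R.
  apply: le_lt_trans (ler_distD (x (f i)) _ _) _.
  by rewrite [ltRHS]splitr ltrD ?Hf // distrC fij Hf.
rewrite -mulrBl normrM normfV [`|2 ^+ m|]gtr0_norm //.
rewrite -[ltRHS]mul1r ltr_pM2r ?invr_gt0 // ltr_norml => /andP[ji ij].
apply/val_inj/anti_leq/andP; split; rewrite leqNgt; apply/negP => /=.
  by rewrite -(ler_nat R) -[j.+1%:R]natr1; lra.
by rewrite -(ler_nat R) -[i.+1%:R]natr1; lra.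
Qed.

End net_radii.

(** * Measurability of the separation and covering radii *)

Section measurability.
Context d (T : measurableType d).

Definition digit_measurable (f : T -> 'F_2) :=
  forall c, measurable (f @^-1` [set c]).

Lemma digit_measurable_cst c : digit_measurable (fun=> c).
Proof.
move=> e; have [->|ce] := eqVneq c e.
  by rewrite (_ : _ @^-1` _ = setT) //; apply/seteqP; split.
rewrite (_ : _ @^-1` _ = set0) //; apply/seteqP; split => // w /= E.
by rewrite E eqxx in ce.
Qed.

Lemma digit_measurableD f g :
  digit_measurable f -> digit_measurable g ->
  digit_measurable (fun w => f w + g w).
Proof.
move=> mf mg c.
rewrite (_ : _ @^-1` _ = \bigcup_a (f @^-1` [set a] `&` g @^-1` [set c - a])).
  apply: fin_bigcup_measurable => [|a _]; first exact: finite_finset.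
  exact: measurableI.
apply/seteqP; split => w /=.
  by move=> <-; exists (f w) => //=; split => //=; rewrite addrC addKr.
by move=> [a _ [/= -> ->]]; rewrite addrC subrK.
Qed.

Lemma digit_measurable_mulr f c :
  digit_measurable f -> digit_measurable (fun w => f w * c).
Proof.
move=> mf; case: (F2P c) => ->.
  by under eq_fun do rewrite mulr0; apply: digit_measurable_cst.
by under eq_fun do rewrite mulr1.
Qed.

Lemma digit_measurable_sum (J : Type) (r : seq J) (f : J -> T -> 'F_2) :
  (forall j, digit_measurable (f j)) ->
  digit_measurable (fun w => \sum_(j <- r) f j w).
Proof.
move=> mf; elim: r => [|j r IH].
  by under eq_fun do rewrite big_nil; apply: digit_measurable_cst.
by under eq_fun do rewrite big_cons; apply: digit_measurableD.
Qed.

Variable R : realType.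

Lemma measurable_digits_val (y : T -> digits) :
  (forall k, digit_measurable (y ^~ k)) ->
  measurable_fun setT (fun w => digits_val R (y w)).
Proof.
move=> my; apply: (@measurable_fun_cvg _ _ _ _
  (fun n w => series (fun k => (nat_of_ord (y w k))%:R / 2 ^+ k.+1 : R) n)).
  move=> n; rewrite /series /=; apply: measurable_sum => k.
  rewrite (_ : (fun w => _) = (fun w => \1_((y ^~ k) @^-1` [set 1]) w / 2 ^+ k.+1)).
    by apply: measurable_funM => //; apply: measurable_indic; apply: my.
  apply/funext => w; congr (_ / _); rewrite indicE.
  have [E|E] := F2P (y w k); first by rewrite memNset /= E.
  by rewrite mem_set /= E.
by move=> w _; apply: digits_val_cvg.
Qed.

Section radii.
Variables (I : finType) (x : T -> I -> R).
Hypothesis mx : forall i, measurable_fun setT (x ^~ i).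

Let measurable_dist_lt c i j : measurable [set w | `|x w i - x w j| < c].
Proof.
have : measurable_fun setT (fun w => `|x w i - x w j|).
  by apply: measurableT_comp => //; apply: measurable_funB.
move=> /(_ measurableT _ (measurable_itv `]-oo, c[)); rewrite setTI.
by congr measurable; apply/seteqP; split => w /=; rewrite in_itv.
Qed.

Let measurable_dist_gt c z i : measurable [set w | c < `|z - x w i|].
Proof.
have : measurable_fun setT (fun w => `|z - x w i|).
  by apply: measurableT_comp => //; apply: measurable_funB.
move=> /(_ measurableT _ (measurable_itv `]c, +oo[)); rewrite setTI.
by congr measurable; apply/seteqP; split => w /=; rewrite in_itv /= andbT.
Qed.

Lemma measurable_Rinf (a0 b0 : I) : a0 != b0 ->
  measurable_fun setT (fun w => Rinf (x w)).
Proof.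
move=> ab0 mD; apply: (measurability _ (RGenInftyO.measurableE R)) => //.
move=> _ [_ [c ->] <-]; rewrite setTI.
rewrite (_ : _ @^-1` _ = \bigcup_(p in [set p : I * I | p.1 != p.2])
                            [set w | `|x w p.1 - x w p.2| < c]).
  by apply: fin_bigcup_measurable => // ; exact: finite_finset.
apply/seteqP; split => w /=; rewrite in_itv /= => H.
  by have [a [b [ab lt]]] := (Rinf_lt _ _ ab0).1 H; exists (a, b).
by case: H => -[a b] /= ab lt; apply/(Rinf_lt _ _ ab0); exists a, b.
Qed.

Lemma measurable_hinf (i0 : I) : (forall w i, 0 <= x w i <= 1) ->
  measurable_fun setT (fun w => hinf (x w)).
Proof.
move=> x01 mD; apply: (measurability _ (RGenOInfty.measurableE R)) => //.
move=> _ [_ [c ->] <-]; rewrite setTI.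
rewrite (_ : _ @^-1` _ = \bigcup_n \bigcup_(k in [set k | (k <= n)%N])
    \bigcap_i [set w | c < `|k%:R / n.+1%:R - x w i|]).
  apply: bigcup_measurable => n _; apply: bigcup_measurable => k _.
  by apply: fin_bigcap_measurable => //; exact: finite_finset.
apply/seteqP; split => w /=; rewrite in_itv /= andbT => H.
  by have [n [k [kn lt]]] := (hinf_gt (x01 w) i0 _).1 H; exists n => //; exists k => // i _; apply: lt.
case: H => n _ [k kn lt]; apply/(hinf_gt (x01 w) i0); exists n, k.
by split => // i; apply: lt.
Qed.

End radii.
End measurability.

(** * Laws that are invariant under translating a block of the matrix *)

(** The part of the matrix and of the shift on which the leading n digits of all
    points depend. *)
Definition config (n : nat) : finType :=
  ({ffun 'I_n * 'I_n -> 'F_2} * {ffun 'I_n -> 'F_2})%type.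

Definition truncation n (L : nat -> nat -> 'F_2) (delta : digits) : config n :=
  ([ffun p : 'I_n * 'I_n => L p.1 p.2], [ffun k : 'I_n => delta k]).

Definition config_matrix n (z : config n) (k j : nat) : 'F_2 :=
  match insub k, insub j with Some k', Some j' => z.1 (k', j') | _, _ => 0 end.

Definition config_shift n (z : config n) : digits :=
  fun k => if insub k is Some k' then z.2 k' else 0.

Definition translate m l (b : 'M['F_2]_(l, m)) (z : config (m + l)) :
    config (m + l) :=
  ([ffun p => z.1 p + block_entry b p.1 p.2], z.2).

Lemma translateK m l (b : 'M['F_2]_(l, m)) : involutive (translate b).
Proof.
move=> [z1 z2]; congr pair; apply/ffunP => p.
by rewrite !ffunE -addrA F2_addxx addr0.
Qed.

Lemma config_matrix_truncation n L delta k j : (k < n)%N -> (j < n)%N ->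
  config_matrix (truncation n L delta) k j = L k j.
Proof.
move=> kn jn; rewrite /config_matrix.
by rewrite (insubT (fun i => i < n)%N kn) (insubT (fun i => i < n)%N jn) /= ffunE.
Qed.

Lemma config_shift_truncation n L delta k : (k < n)%N ->
  config_shift (truncation n L delta) k = delta k.
Proof.
by move=> kn; rewrite /config_shift (insubT (fun i => i < n)%N kn) /= ffunE.
Qed.

Lemma config_matrix_translate m l (b : 'M['F_2]_(l, m)) (z : config (m + l)) k j :
  (k < m + l)%N -> (j < m + l)%N ->
  config_matrix (translate b z) k j = add_block b (config_matrix z) k j.
Proof.
move=> kn jn; rewrite /add_block /config_matrix.
rewrite (insubT (fun i => i < m + l)%N kn) (insubT (fun i => i < m + l)%N jn).
by rewrite /= ffunE.
Qed.

Section law.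
Context (R : realType) d (T : measurableType d) (P : probability T R).
Variables (L : T -> nat -> nat -> 'F_2) (delta : T -> digits).

Definition cylinder n (z : config n) :=
  [set w | truncation n (L w) (delta w) = z].

(** What the two kinds of scrambling have in common. A deterministic shift is a
    constant function here. *)
Record scrambling_law : Prop := ScramblingLaw {
  scr_ult : forall w, unit_lower_triangular (L w);
  scr_measurable_entry : forall k j, digit_measurable (fun w => L w k j);
  scr_measurable_shift : forall k, digit_measurable (delta ^~ k);
  scr_translate : forall m l (b : 'M['F_2]_(l, m)) (z : config (m + l)),
    P (cylinder (translate b z)) = P (cylinder z) }.

Hypothesis law : scrambling_law.

Lemma cylinderE n (z : config n) :
  cylinder z = (\bigcap_(p in [set: 'I_n * 'I_n]) [set w | L w p.1 p.2 = z.1 p])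
    `&` (\bigcap_(k in [set: 'I_n]) [set w | delta w k = z.2 k]).
Proof.
apply/seteqP; split => w.
  by move=> <-; split => [p _|k _] /=; rewrite ffunE.
move=> [H1 H2]; rewrite /cylinder /truncation /= [z]surjective_pairing.
by congr pair; apply/ffunP => i; rewrite ffunE; [apply: H1 | apply: H2].
Qed.

Lemma measurable_cylinder n (z : config n) : measurable (cylinder z).
Proof.
rewrite cylinderE; apply: measurableI; apply: fin_bigcap_measurable;
  rewrite ?setT0 //; try exact: finite_finset.
- by move=> p _; apply: scr_measurable_entry.
- by move=> k _; apply: scr_measurable_shift.
Qed.

Lemma preimage_truncationE n (D : pred (config n)) :
  [set w | D (truncation n (L w) (delta w))]
  = \bigcup_(z in [set z | D z]) cylinder z.
Proof.
apply/seteqP; split => [w Dw|w [z Dz wz]].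
  by exists (truncation n (L w) (delta w)).
by rewrite /= [truncation _ _ _]wz.
Qed.

Lemma prob_truncation n (D : pred (config n)) :
  P [set w | D (truncation n (L w) (delta w))] = (\sum_(z | D z) P (cylinder z))%E.
Proof.
rewrite preimage_truncationE measure_fin_bigcup.
- rewrite (_ : [set z | D z] = [set` enum D]).
    by rewrite -fsbig_seq ?enum_uniq // big_enum.
  by apply/seteqP; split => z /=; rewrite mem_enum.
- exact: finite_finset.
- by move=> z z' _ _ [w [<- <-]].
- by move=> z _; apply: measurable_cylinder.
Qed.

Lemma measurable_truncation n (D : pred (config n)) :
  measurable [set w | D (truncation n (L w) (delta w))].
Proof.
rewrite preimage_truncationE; apply: fin_bigcup_measurable.
  exact: finite_finset.
by move=> z _; apply: measurable_cylinder.
Qed.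

(** Conditionally on everything outside the block, the block is uniform; hence a
    bound on the proportion of blocks that realise an event, valid for every
    value of the rest, bounds the probability of the event. *)
Lemma prob_le_block_proportion m l (D : pred (config (m + l))) (q : R) :
  (forall w, (#|[pred b : 'M['F_2]_(l, m) |
       D (translate b (truncation (m + l) (L w) (delta w)))]|%:R
     <= q * #|{: 'M['F_2]_(l, m)}|%:R)) ->
  (P [set w | D (truncation (m + l) (L w) (delta w))] <= q%:E)%E.
Proof.
move=> le; pose G := 'M['F_2]_(l, m).
pose p (z : config (m + l)) : R := fine (P (cylinder z)).
have pE z : P (cylinder z) = (p z)%:E.
  by rewrite fineK // fin_num_measure //; apply: measurable_cylinder.
have ptr b z : p (translate b z) = p z by rewrite /p (scr_translate law).
have probE (E : pred (config (m + l))) :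
    P [set w | E (truncation (m + l) (L w) (delta w))] = (\sum_(z | E z) p z)%:E.
  by rewrite prob_truncation -sumEFin; apply: eq_bigr => z _.
have p1 : \sum_z p z = 1.
  apply/EFin_inj; rewrite -(probE predT) (_ : [set w | _] = setT) ?probability_setT //.
  by apply/seteqP; split.
have G0 : 0 < #|{: G}|%:R :> R by rewrite ltr0n; apply/card_gt0P; exists 0.
rewrite probE lee_fin -(ler_pM2l G0).
have -> : #|{: G}|%:R * (\sum_(z | D z) p z)
        = \sum_z p z * #|[pred b : G | D (translate b z)]|%:R.
  transitivity (\sum_(b : G) \sum_(z | D (translate b z)) p z).
    rewrite -sumr_const mulr_suml; apply: eq_bigr => b _; rewrite mul1r.
    rewrite (reindex_inj (inv_inj (translateK b))) /=.
    by apply: eq_bigr => z _; rewrite ptr.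
  rewrite (exchange_big_dep predT) //=; apply: eq_bigr => z _.
  by rewrite sumr_const mulr_natr.
rewrite [leRHS]mulrC -[leRHS]mul1r -[X in _ <= X * _]p1 mulr_suml; apply: ler_sum => z _.
have [[w wz]|nz] := pselect (exists w, cylinder z w).
  by rewrite ler_wpM2l //; [rewrite fine_ge0 | move: (le w); rewrite wz].
rewrite (_ : p z = 0) ?mul0r //.
rewrite /p (_ : cylinder z = set0) ?measure0 //.
by apply/seteqP; split => // w zw; apply: nz; exists w.
Qed.

End law.

(** * The law of a scrambling matrix and of a random shift *)

Section iid.
Context (R : realType) d (T : measurableType d) (P : probability T R).

Lemma iid_uniform_cylinder (I : eqType) (X : I -> T -> 'F_2) (J : seq I) c :
  iid_uniform P X -> uniq J ->
  P [set w | forall i, i \in J -> X i w = c i] = (2^-1 ^+ size J)%:E.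
Proof.
move=> [_ unif indep] uJ.
have := indep J (fun i => [set c i]) uJ.
rewrite (_ : \bigcap_(i in _) _ = [set w | forall i, i \in J -> X i w = c i]); last first.
  by apply/seteqP; split => w H i; apply: H.
move=> ->; under eq_bigr do rewrite unif.
rewrite prodEFin; congr EFin.
by elim: (J) => [|j s IH]; rewrite ?big_nil // big_cons IH exprS.
Qed.

Definition below_pairs n : seq below_diag :=
  pmap insub [seq (k, j) | k <- iota 0 n, j <- iota 0 n].

Lemma below_pairs_uniq n : uniq (below_pairs n).
Proof.
apply/pmap_sub_uniq/allpairs_uniq; rewrite ?iota_uniq //.
by move=> [? ?] [? ?] _ _ /= [-> ->].
Qed.

Lemma mem_below_pairs n (p : below_diag) :
  (p \in below_pairs n) = ((val p).1 < n)%N.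
Proof.
rewrite mem_pmap_sub; apply/allpairsP/idP => [[[k j] /=]|].
  by rewrite !mem_iota => -[/andP[_ ?] _ ->].
move=> pn; exists (val p); rewrite !mem_iota pn (ltn_trans (valP p) pn).
by split => //; rewrite -surjective_pairing.
Qed.

Definition config_ult n (z : config n) : bool :=
  [forall k, z.1 (k, k) == 1] &&
  [forall k : 'I_n, [forall j : 'I_n, (k < j)%N ==> (z.1 (k, j) == 0)]].

Lemma config_ult_translate m l (b : 'M['F_2]_(l, m)) (z : config (m + l)) :
  config_ult (translate b z) = config_ult z.
Proof.
have E (k j : 'I_(m + l)) : (k <= j)%N -> (translate b z).1 (k, j) = z.1 (k, j).
  by move=> kj; rewrite ffunE /= block_entry_upper ?addr0.
congr (_ && _).
  by apply: eq_forallb => k; rewrite E.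
apply: eq_forallb => k; apply: eq_forallb => j.
by case: ltnP => //= kj; rewrite E // ltnW.
Qed.

(** The entries on and above the diagonal are forced, so a cylinder is either empty
    or cut out by the independent entries below the diagonal and by the shift. *)
Lemma truncation_ult n L delta (z : config n) : unit_lower_triangular L ->
  truncation n L delta = z <->
  [/\ config_ult z,
      forall p : below_diag, ((val p).1 < n)%N ->
        L (val p).1 (val p).2 = config_matrix z (val p).1 (val p).2
    & forall k, (k < n)%N -> delta k = config_shift z k].
Proof.
move=> [diag up]; split => [<-|[/andP[/forallP zd /forallP zu] H1 H2]].
  split=> [|p pn|k kn]; last by rewrite config_shift_truncation.
    apply/andP; split; apply/forallP => k; first by rewrite ffunE diag.
    by apply/forallP => j; apply/implyP => kj; rewrite ffunE up.
  by rewrite config_matrix_truncation // (ltn_trans (valP p)).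
rewrite [z]surjective_pairing; congr pair; apply/ffunP; [case=> k j | move=> k];
  rewrite ffunE /=.
  case: (ltngtP k j) => [kj|jk|/val_inj->].
  - by rewrite up //; have /forallP/(_ j)/implyP/(_ kj)/eqP := zu k.
  - have := H1 (exist _ (nat_of_ord k, nat_of_ord j) jk); rewrite /= => -> //.
    by rewrite /config_matrix !valK.
  - by rewrite diag; have /eqP := zd j.
by rewrite H2 // /config_shift valK.
Qed.

Lemma measurable_matrix_entry (L : T -> nat -> nat -> 'F_2) :
  (forall w, unit_lower_triangular (L w)) ->
  (forall p : below_diag, digit_measurable (below_entry L p)) ->
  forall k j, digit_measurable (fun w => L w k j).
Proof.
move=> ult mL k j; case: (ltngtP k j) => [kj|jk|<-].
- rewrite (_ : (fun w => _) = fun=> 0); first exact: digit_measurable_cst.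
  by apply/funext => w; case: (ult w) => _ ->.
- exact: (mL (exist _ (k, j) jk)).
- rewrite (_ : (fun w => _) = fun=> 1); first exact: digit_measurable_cst.
  by apply/funext => w; case: (ult w) => ->.
Qed.

(** All nonempty cylinders have the same probability, and translating the block
    does not affect whether a cylinder is empty. *)
Lemma matrix_scrambling_law (L : T -> nat -> nat -> 'F_2) (delta : digits) :
  random_scrambling_matrix P L -> scrambling_law P L (fun=> delta).
Proof.
move=> [ult iid]; have [mX _ _] := iid.
have cylE n (z : config n) : P (cylinder L (fun=> delta) z) =
    if config_ult z && [forall k : 'I_n, z.2 k == delta k]
    then (2^-1 ^+ size (below_pairs n))%:E else 0%E.
  case: ifP => [/andP[zu /forallP zd]|nz].
    rewrite -(iid_uniform_cylinder (fun p => config_matrix z (val p).1 (val p).2)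
      iid (below_pairs_uniq n)).
    congr (P _); apply/seteqP; split => w.
      move=> /(truncation_ult _ _ (ult w))[_ H _] p.
      by rewrite mem_below_pairs; apply: H.
    move=> H; apply/(truncation_ult _ _ (ult w)); split => // [p pn|k kn].
      by apply: H; rewrite mem_below_pairs.
    rewrite /config_shift (insubT (fun i => i < n)%N kn) /=.
    by rewrite (eqP (zd _)).
  rewrite (_ : cylinder _ _ z = set0) ?measure0 //.
  apply/seteqP; split => // w zw; have := zw.
  move=> /(truncation_ult _ _ (ult w))[zu _ _].
  move: nz; rewrite zu /= => /negP; apply; apply/forallP => k.
  by rewrite -zw ffunE.
split=> // [|k|m l b z].
- exact: measurable_matrix_entry ult (fun p c => mX p [set c]).
- exact: digit_measurable_cst.
- by rewrite !cylE config_ult_translate.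
Qed.

Lemma linear_scrambling_law (L : T -> nat -> nat -> 'F_2) (delta : T -> digits) :
  random_linear_scrambling P L delta -> scrambling_law P L delta.
Proof.
move=> [ult iid]; have [mX _ _] := iid.
pose J n : seq (below_diag + nat) :=
  map inl (below_pairs n) ++ map inr (iota 0 n).
have uJ n : uniq (J n).
  rewrite cat_uniq !map_inj_uniq ?below_pairs_uniq ?iota_uniq /=; last 2 first.
  - by move=> ? ? [].
  - by move=> ? ? [].
  by rewrite andbT; apply/hasPn => _ /mapP[k _ ->]; apply/mapP => -[].
have cylE n (z : config n) : P (cylinder L delta z) =
    if config_ult z then (2^-1 ^+ size (J n))%:E else 0%E.
  case: ifP => [zu|nz].
    rewrite -(iid_uniform_cylinder (fun s => match s with
      | inl p => config_matrix z (val p).1 (val p).2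
      | inr k => config_shift z k end) iid (uJ n)).
    congr (P _); apply/seteqP; split => w.
      move=> /(truncation_ult _ _ (ult w))[_ H1 H2] s.
      rewrite mem_cat => /orP[] /mapP[i + ->].
        by rewrite mem_below_pairs; apply: H1.
      by rewrite mem_iota; apply: H2.
    move=> H; apply/(truncation_ult _ _ (ult w)); split => // [p pn|k kn].
      by apply: (H (inl p)); rewrite mem_cat map_f // mem_below_pairs.
    by apply: (H (inr k)); rewrite mem_cat orbC map_f // mem_iota.
  rewrite (_ : cylinder _ _ z = set0) ?measure0 //.
  apply/seteqP; split => // w /(truncation_ult _ _ (ult w))[zu _ _].
  by rewrite zu in nz.
split=> // [|k|m l b z].
- exact: measurable_matrix_entry ult (fun p c => mX (inl p) [set c]).
- exact: (fun c => mX (inr k) [set c]).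
- by rewrite !cylE config_ult_translate.
Qed.

End iid.

(** * Tail bounds *)

Section tails.
Context (R : realType) d (T : measurableType d) (P : probability T R).
Variables (m : nat) (C : nat -> 'I_m -> 'F_2).
Variables (L : T -> nat -> nat -> 'F_2) (delta : T -> digits).
Hypotheses (netC : digital_0m1_net C) (law : scrambling_law P L delta).
Notation x := (fun w => scr_points R C (L w) (delta w)).

Lemma measurable_scr_points a : measurable_fun setT (x ^~ a).
Proof.
apply: measurable_digits_val => k; rewrite /scramble.
apply: digit_measurableD; last exact: scr_measurable_shift law k.
apply: digit_measurable_sum => j; apply: digit_measurable_mulr.
exact: scr_measurable_entry law k j.
Qed.

Lemma measurable_scr_Rinf : (0 < m)%N ->
  measurable_fun setT (fun w => Rinf (x w)).
Proof.
move=> /exists_neq_ffun[a [b ab]].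
exact: measurable_Rinf measurable_scr_points _ _ ab.
Qed.

Lemma measurable_scr_hinf : measurable_fun setT (fun w => hinf (x w)).
Proof.
apply: (measurable_hinf measurable_scr_points 0) => w a.
exact: scr_points01.
Qed.

Lemma measurable_lt (f g : T -> R) :
  measurable_fun setT f -> measurable_fun setT g ->
  measurable [set w | f w < g w].
Proof.
move=> mf mg; have /(_ measurableT [set true] I) := measurable_fun_ltr mf mg.
by rewrite setTI; congr measurable; apply/seteqP; split.
Qed.

Lemma config_matrix_translate_truncation l (b : 'M['F_2]_(l, m)) w k j :
  (k < m + l)%N -> (j < m + l)%N ->
  config_matrix (translate b (truncation (m + l) (L w) (delta w))) k j
  = add_block b (L w) k j.
Proof.
move=> kn jn; rewrite config_matrix_translate // /add_block.
by rewrite config_matrix_truncation.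
Qed.

Lemma prob_Rinf_lt l : (0 < m)%N ->
  (P [set w | (Rinf (x w) < 2 ^- (m + l))%R] <= (m%:R / 2 ^+ l)%:E)%E.
Proof.
move=> m0; pose D (z : config (m + l)) : bool :=
  `[< close_pair C (config_matrix z) (m + l) >].
apply: (@le_trans _ _ (P [set w | D (truncation (m + l) (L w) (delta w))])).
  apply: le_measure; rewrite ?inE.
  - by apply: measurable_lt => //; apply: measurable_scr_Rinf.
  - exact: (measurable_truncation law).
  - move=> w /= lt; apply/asboolP.
    apply: (@eq_close_pair _ _ (L w)) => [k j kn jn|].
      by rewrite config_matrix_truncation.
    apply: (@Rinf_lt_close_pair R _ _ _ (delta w) netC (scr_ult law w)) => //.
    by rewrite m0 leq_addr.
apply: (prob_le_block_proportion law) => w.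
rewrite mulrAC ler_pdivlMr ?exprn_gt0 // -natrX -!natrM ler_nat.
apply: leq_trans (card_close_pair l netC (scr_ult law w)).
rewrite leq_mul2r; apply/orP; right; apply/subset_leq_card/fintype.subsetP => b.
rewrite !inE => H; apply: (eq_close_pair _ H) => k j kn jn.
by rewrite config_matrix_translate_truncation.
Qed.

Lemma prob_Rinf_gt l : (1 < m)%N ->
  (P [set w | (2 * 2 ^- (m + l) < Rinf (x w))%R] <= (9 * 2 ^+ l / m%:R)%:E)%E.
Proof.
move=> m1; pose D (z : config (m + l)) : bool :=
  `[< ~ consecutive_pair C (config_matrix z) (config_shift z) (m + l) >].
apply: (@le_trans _ _ (P [set w | D (truncation (m + l) (L w) (delta w))])).
  apply: le_measure; rewrite ?inE.
  - by apply: measurable_lt => //; apply: measurable_scr_Rinf; apply: ltnW.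
  - exact: (measurable_truncation law).
  - move=> w /= lt; apply/asboolP => cons.
    move: lt; apply/negP; rewrite -leNgt.
    apply: (consecutive_pair_Rinf_le R (leq_addr l m)).
    apply: (eq_consecutive_pair _ _ _ cons) => [|k j kn jn|k kn]; first exact: leq_addr.
      by rewrite config_matrix_truncation.
    by rewrite config_shift_truncation.
apply: (prob_le_block_proportion law) => w.
rewrite mulrAC ler_pdivlMr ?ltr0n 1?ltnW // -natrX -!natrM ler_nat.
rewrite -mulnA [(2 ^ l * _)%N]mulnC.
apply: leq_trans (card_no_consecutive_pair l netC (delta w) (scr_ult law w) m1).
rewrite leq_mul2r; apply/orP; right; apply/subset_leq_card/fintype.subsetP => b.
rewrite !inE => H cons; apply: H.
apply: (eq_consecutive_pair _ _ _ cons) => [|k j kn jn|k kn]; first exact: leq_addr.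
  by rewrite config_matrix_translate_truncation.
by rewrite -(config_shift_truncation (L w) (delta w) kn).
Qed.

Lemma pow2_bracket (X : R) : 1 <= X ->
  exists l : nat, 2 ^+ l <= X < 2 * 2 ^+ l.
Proof.
move=> X1; have X0 : 0 <= X by apply: le_trans X1.
have /andP[tl tu] := trunc_itv X0.
have t0 : (0 < Num.truncn X)%N by rewrite truncn_gt0.
have /andP[ll lu] := @trunc_log_bounds 2 _ isT t0.
exists (trunc_log 2 (Num.truncn X)); rewrite -exprS -!natrX; apply/andP; split.
  by apply: le_trans tl; rewrite ler_nat.
by apply: lt_le_trans tu _; rewrite ler_nat.
Qed.

(** With [2 ^ l] the power of 2 just below [8 * u * m], the bound [m / 2 ^ l] is at
    most [1 / (4 * u)]. *)
Lemma Rinf_lower_tail (u : R) : (0 < m)%N -> 1 <= u ->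
  (P [set w | (Rinf (x w) < 1 / (8 * u) * (2 ^- m / m%:R))%R]
     <= (9 * u^-1)%:E)%E.
Proof.
move=> m0 u1; have m1 : 1 <= m%:R :> R by rewrite ler1n.
have u0 : 0 < u by apply: lt_le_trans u1.
have um : 1 <= u * m%:R by rewrite mulr_ege1.
have [|l /andP[lX Xl]] := @pow2_bracket (8 * u * m%:R); first by lra.
have e0 : 0 < 2 ^+ l :> R by rewrite exprn_gt0.
have X0 : 0 < 8 * u * m%:R by apply: lt_le_trans lX.
have le : 1 / (8 * u) * (2 ^- m / m%:R) <= 2 ^- (m + l) :> R.
  rewrite exprD [leRHS]invfM mul1r mulrCA ler_pM2l ?invr_gt0 ?exprn_gt0 //.
  by rewrite -invfM lef_pV2 ?posrE.
apply: (@le_trans _ _ (P [set w | (Rinf (x w) < 2 ^- (m + l))%R])).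
  apply: le_measure; rewrite ?inE.
  - by apply: measurable_lt => //; apply: measurable_scr_Rinf.
  - by apply: measurable_lt => //; apply: measurable_scr_Rinf.
  - by move=> w /= lt; apply: lt_le_trans le.
apply: le_trans (prob_Rinf_lt l m0) _; rewrite lee_fin.
rewrite ler_pdivrMr // mulrAC ler_pdivlMr //.
apply: (@le_trans _ _ (2 * 2 ^+ l)); last by rewrite ler_pM2r // ler_nat.
apply: le_trans (ltW Xl); rewrite -mulrA [m%:R * u]mulrC ler_peMl ?ler1n //.
exact: le_trans um.
Qed.

(** Here [2 ^ l.+1] is the power of 2 just above [m / (4 * u)]; the assumption on
    [u] makes this quotient at least 1. *)
Lemma Rinf_upper_tail (u : R) : (1 < m)%N -> 1 <= u -> u <= m%:R / 4 ->
  (P [set w | (8 * u * (2 ^- m / m%:R) < Rinf (x w))%R] <= (9 * u^-1)%:E)%E.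
Proof.
move=> m1 u1 um.
have m0 : 0 < m%:R :> R by rewrite ltr0n ltnW.
have u0 : 0 < u by apply: lt_le_trans u1.
have [|l /andP[lY Yl]] := @pow2_bracket (m%:R / (4 * u)).
  by rewrite ler_pdivlMr ?mulr_gt0 //; lra.
have e0 : 0 < 2 ^+ l :> R by rewrite exprn_gt0.
rewrite ler_pdivlMr ?mulr_gt0 // in lY; rewrite ltr_pdivrMr ?mulr_gt0 // in Yl.
have le : 2 * 2 ^- (m + l.+1) <= 8 * u * (2 ^- m / m%:R) :> R.
  rewrite exprD [(_ * _)^-1]invfM mulrCA [leRHS]mulrCA ler_pM2l ?invr_gt0 ?exprn_gt0 //.
  rewrite exprS ler_pdivlMr // mulrAC ler_pdivrMr ?mulr_gt0 //; lra.
apply: (@le_trans _ _ (P [set w | (2 * 2 ^- (m + l.+1) < Rinf (x w))%R])).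
  apply: le_measure; rewrite ?inE.
  - by apply: measurable_lt => //; apply: measurable_scr_Rinf; apply: ltnW.
  - by apply: measurable_lt => //; apply: measurable_scr_Rinf; apply: ltnW.
  - by move=> w /= lt; apply: le_lt_trans lt.
apply: le_trans (prob_Rinf_gt l.+1 m1) _; rewrite lee_fin.
rewrite ler_pdivrMr // mulrAC ler_pdivlMr // exprS; lra.
Qed.

End tails.

(** * Stochastic orders *)

Section stochastic_orders.
Variables (R : realType) (C : forall m : nat, nat -> 'I_m -> 'F_2).
Hypothesis netC : forall m, digital_0m1_net (@C m).
Variables (d : nat -> measure_display) (T : forall m, measurableType (d m)).
Variables (P : forall m, probability (T m) R) (I : Type).
Variables (L : I -> forall m, T m -> nat -> nat -> 'F_2).
Variables (delta : I -> forall m, T m -> digits).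
Hypothesis law : forall i m, scrambling_law (P m) (@L i m) (@delta i m).
Notation x i m w := (scr_points R (@C m) (@L i m w) (@delta i m w)).

(** The deviation [u] that brings the tail bounds below a given [eps]. *)
Lemma exists_deviation (eps : R) : 0 < eps -> exists (u : R) (m0 : nat),
  [/\ 1 <= u, 9 * u^-1 <= eps
    & forall m, (m0 <= m)%N -> (1 < m)%N /\ u <= m%:R / 4].
Proof.
move=> e0; pose u := Num.max 1 (9 / eps).
have u1 : 1 <= u by rewrite le_max lexx.
have u0 : 0 < u by apply: lt_le_trans u1.
exists u, (Num.truncn (4 * u)).+2; split => // [|m mm].
  by rewrite ler_pdivrMr // mulrC -ler_pdivrMr // le_max lexx orbT.
split; first exact: leq_trans mm.
rewrite ler_pdivlMr // mulrC; apply: ltW.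
by rewrite -truncn_lt_nat ?mulr_ge0 ?ltW // ltnW.
Qed.

Lemma scr_Rinf_ThetaP :
  unif_ThetaP P (fun i m w => (Rinf (x i m w))%:E) (fun m => 2 ^- m * m%:R^-1).
Proof.
split=> eps /exists_deviation[u [m0 [u1 ueps um]]]; exists (8 * u);
  (split; first by rewrite mulr_gt0 // (lt_le_trans _ u1)); exists m0 => i m;
  move=> /um[m1 umm].
  apply: (@le_trans _ _ (9 * u^-1)%:E); last by rewrite lee_fin.
  rewrite (_ : [set w | _] = [set w | (8 * u * (2 ^- m / m%:R) < Rinf (x i m w))%R]).
    exact: (Rinf_upper_tail (@netC m) (@law i m)).
  by apply/seteqP; split => w /=; rewrite lte_fin ger0_norm // Rinf_ge0.
apply: (@le_trans _ _ (9 * u^-1)%:E); last by rewrite lee_fin.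
rewrite (_ : [set w | _] =
    [set w | (Rinf (x i m w) < 1 / (8 * u) * (2 ^- m / m%:R))%R]).
  by apply: (Rinf_lower_tail (@netC m) (@law i m)) => //; apply: ltnW.
have c0 : 0 < 8 * u by rewrite mulr_gt0 // (lt_le_trans _ u1).
have a0 : 0 < 2 ^- m / m%:R :> R.
  by rewrite divr_gt0 ?invr_gt0 ?exprn_gt0 // ltr0n ltnW.
suff E w : (((8 * u * 1)%:E < `|(2 ^- m / m%:R)%:E / (Rinf (x i m w))%:E|)%E
    = (Rinf (x i m w) < 1 / (8 * u) * (2 ^- m / m%:R))%R).
  by apply/seteqP; split => w /=; rewrite E.
rewrite mulr1 inver; case: eqP => [->|/eqP r0].
  rewrite gt0_muley ?lte_fin //= ltry; apply/esym/mulr_gt0 => //.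
  exact: divr_gt0.
have rp : 0 < Rinf (x i m w) by rewrite lt0r r0 Rinf_ge0.
rewrite -EFinM abse_EFin lte_fin ger0_norm; last by rewrite divr_ge0 // ltW.
rewrite ltr_pdivlMr // [1 / _ * _]mulrAC mul1r [RHS]ltr_pdivlMr //.
by rewrite [_ * (8 * u)]mulrC.
Qed.

(** Both events are of the form [c * Rinf < c' * hinf], including the case
    [Rinf = 0] since [hinf] is positive; [net_hinf_ge] and [net_hinf_le] then
    compare them with tail events of [Rinf]. *)
Lemma scr_rhoinf_ThetaP :
  unif_ThetaP P (fun i m w => rhoinf (x i m w)) (fun m => m%:R).
Proof.
have hb i m w : 2 ^- m / 2 <= hinf (x i m w) <= 2 ^- m.
  have ult := scr_ult (@law i m) w.
  by apply/andP; split; [apply: net_hinf_ge | apply: net_hinf_le].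
have h0 i m w : 0 < hinf (x i m w).
  have /andP[h _] := hb i m w; apply: lt_le_trans h.
  by rewrite divr_gt0 // invr_gt0 exprn_gt0.
have mh i m := measurable_scr_hinf (@C m) (@law i m).
have mR i m : (1 < m)%N -> measurable_fun setT (fun w => Rinf (x i m w)).
  by move=> m1; apply: (measurable_scr_Rinf (@C m) (@law i m)); apply: ltnW.
split=> eps /exists_deviation[u [m0 [u1 ueps um]]].
  have u0 : 0 < u by apply: lt_le_trans u1.
  exists (16 * u); split; first by rewrite mulr_gt0.
  exists m0 => i m /um[m1 umm].
  have mp : 0 < m%:R :> R by rewrite ltr0n ltnW.
  apply: (@le_trans _ _ (9 * u^-1)%:E); last by rewrite lee_fin.
  rewrite (_ : [set w | _] = [set w | 16 * u * m%:R * Rinf (x i m w)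
                                      < 2 * hinf (x i m w)]); last first.
    suff E w : (((16 * u * m%:R)%:E < `|rhoinf (x i m w)|)%E
        = (16 * u * m%:R * Rinf (x i m w) < 2 * hinf (x i m w))%R).
      by apply/seteqP; split => w /=; rewrite E.
    rewrite /rhoinf; case: eqP => [->|/eqP r0].
      by rewrite mulr0 mulr_gt0 // ltry.
    have rp : 0 < Rinf (x i m w) by rewrite lt0r r0 Rinf_ge0.
    rewrite abse_EFin lte_fin ger0_norm ?divr_ge0 ?mulr_ge0 ?ltW //.
    by rewrite ltr_pdivlMr.
  apply: le_trans (Rinf_lower_tail (@netC m) (@law i m) (ltnW m1) u1).
  apply: le_measure; rewrite ?inE.
  - by apply: measurable_lt; apply: measurable_funM => //; apply: mR.
  - by apply: measurable_lt => //; apply: mR.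
  - move=> w /= lt; have /andP[_ hm] := hb i m w.
    rewrite mul1r mulrC ltr_pdivlMr ?mulr_gt0 // ltr_pdivlMr //.
    by move: lt; rewrite -!mulrA; lra.
have u0 : 0 < u by apply: lt_le_trans u1.
exists (8 * u); split; first by rewrite mulr_gt0.
exists m0 => i m /um[m1 umm].
have mp : 0 < m%:R :> R by rewrite ltr0n ltnW.
apply: (@le_trans _ _ (9 * u^-1)%:E); last by rewrite lee_fin.
rewrite (_ : [set w | _] = [set w | 8 * u * (2 * hinf (x i m w))
                                    < m%:R * Rinf (x i m w)]); last first.
  suff E w : (((8 * u * 1)%:E < `|(m%:R)%:E / rhoinf (x i m w)|)%E
      = (8 * u * (2 * hinf (x i m w)) < m%:R * Rinf (x i m w))%R).
    by apply/seteqP; split => w /=; rewrite E.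
  rewrite /rhoinf mulr1; case: eqP => [->|/eqP r0].
    rewrite invey mule0 abse0 mulr0 lte_fin; apply/idP/idP => /lt_geF.
      by rewrite mulr_ge0 // ltW.
    by rewrite !mulr_ge0 // ltW.
  have rp : 0 < Rinf (x i m w) by rewrite lt0r r0 Rinf_ge0.
  have qp : 0 < 2 * hinf (x i m w) / Rinf (x i m w).
    by rewrite divr_gt0 // mulr_gt0.
  rewrite inver gt_eqF // -EFinM abse_EFin lte_fin ger0_norm; last first.
    by rewrite divr_ge0 // ltW.
  by rewrite ltr_pdivlMr // [_ * (_ / _)]mulrA ltr_pdivrMr.
apply: le_trans (Rinf_upper_tail (@netC m) (@law i m) m1 u1 umm).
apply: le_measure; rewrite ?inE.
- by apply: measurable_lt; do ?apply: measurable_funM => //; apply: mR.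
- by apply: measurable_lt => //; apply: mR.
- move=> w /= lt; have /andP[hm _] := hb i m w.
  rewrite mulrA ltr_pdivrMr // [ltRHS]mulrC; apply: le_lt_trans lt.
  by rewrite ler_pM2l ?mulr_gt0 // mulrC -ler_pdivrMr.
Qed.

Lemma scr_Rinf_tails : exists (K : R) (m0 : nat), 0 < K /\
  forall i m (u : R), (m0 <= m)%N -> 1 <= u -> u <= m%:R / 4 ->
    (P m [set w | (Rinf (x i m w) < 1 / (8 * u) * (2 ^- m / m%:R))%R]
       <= (K * u^-1)%:E)%E /\
    (P m [set w | (8 * u * (2 ^- m / m%:R) < Rinf (x i m w))%R]
       <= (K * u^-1)%:E)%E.
Proof.
exists 9, 2%N; split => // i m u m1 u1 um; split.
  by apply: (Rinf_lower_tail (@netC m) (@law i m)) => //; apply: ltnW.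
exact: (Rinf_upper_tail (@netC m) (@law i m)).
Qed.

End stochastic_orders.

Theorem corollary5p12 (R : realType)
    (C : forall m : nat, nat -> 'I_m -> 'F_2)
    (netC : forall m, digital_0m1_net (C m))
    (d : nat -> measure_display) (T : forall m, measurableType (d m))
    (P : forall m, probability (T m) R) :
  (* matrix scrambling with a fixed digital shift, uniformly over the shift *)
  (forall L : forall m, T m -> nat -> nat -> 'F_2,
     (forall m, random_scrambling_matrix (P m) (L m)) ->
     let pts (delta : digits) (m : nat) (w : T m) :=
       scr_points R (C m) (L m w) delta in
     [/\ unif_ThetaP P (fun delta m w => (Rinf (pts delta m w))%:E)
           (fun m => 2 ^- m * m%:R^-1),
         unif_ThetaP P (fun delta m w => rhoinf (pts delta m w))
           (fun m => m%:R)
       & exists (K : R) (m0 : nat), 0 < K /\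
           forall (delta : digits) (m : nat) (u : R), (m0 <= m)%N ->
             1 <= u -> u <= m%:R / 4 ->
             (P m [set w | (Rinf (pts delta m w) <
                              1 / (8 * u) * (2 ^- m / m%:R))%R]
                <= (K * u^-1)%:E)%E /\
             (P m [set w | (8 * u * (2 ^- m / m%:R) <
                              Rinf (pts delta m w))%R]
                <= (K * u^-1)%:E)%E])
  /\
  (* linear scrambling *)
  (forall (L : forall m, T m -> nat -> nat -> 'F_2)
          (delta : forall m, T m -> digits),
     (forall m, random_linear_scrambling (P m) (L m) (delta m)) ->
     let pts (m : nat) (w : T m) :=
       scr_points R (C m) (L m w) (delta m w) in
     [/\ ThetaP P (fun m w => (Rinf (pts m w))%:E)
           (fun m => 2 ^- m * m%:R^-1),
         ThetaP P (fun m w => rhoinf (pts m w))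
           (fun m => m%:R)
       & exists (K : R) (m0 : nat), 0 < K /\
           forall (m : nat) (u : R), (m0 <= m)%N ->
             1 <= u -> u <= m%:R / 4 ->
             (P m [set w | (Rinf (pts m w) <
                              1 / (8 * u) * (2 ^- m / m%:R))%R]
                <= (K * u^-1)%:E)%E /\
             (P m [set w | (8 * u * (2 ^- m / m%:R) <
                              Rinf (pts m w))%R]
                <= (K * u^-1)%:E)%E]).
Proof.
split=> [L Llaw pts|L delta Llaw pts].
  have law (delta : digits) m := matrix_scrambling_law delta (Llaw m).
  split; first exact: (scr_Rinf_ThetaP netC law).
    exact: (scr_rhoinf_ThetaP netC law).
  exact: (scr_Rinf_tails netC law).
have law (_ : unit) m := linear_scrambling_law (Llaw m).
split; first exact: (scr_Rinf_ThetaP netC law).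
  exact: (scr_rhoinf_ThetaP netC law).
have [K [m0 [K0 H]]] := scr_Rinf_tails netC law.
by exists K, m0; split => // m u; apply: (H tt).
Qed.
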